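(* Let $\lambda>0$ be given, and let $N\geq 1$. The following properties of a function $f:(0,\infty)\to\mathbb R$ are equivalent. (a) $f\in\mathcal C_N^{\lambda}$; (b) $f$ can be represented as $$f(x)=c+\int_0^{\infty}e^{-xs}s^{\lambda-1}\,d\mu(s),$$ where $c\geq 0$, and $\mu$ is a positive measure on $(0,\infty)$ for which $\mu_k\equiv(-1)^ks^k\partial^k\mu$ (in the distributional sense) is a positive measure such that $$\int_0^{\infty}e^{-xs}s^{\lambda-1}\,d\mu_k(s)<\infty,\quad k=0,\ldots,N.$$ In the affirmative case, $$c_k^{\lambda}(f)(x)=x^{1-\lambda}\left(x^{\lambda-1+k}f(x)\right)^{(k)}=\int_0^{\infty}e^{-xs}s^{\lambda-1}\,d\mu_k(s)$$ for $k=0,\ldots,N$.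
   Context: Here $x$ ranges over $(0,\infty)$, and $N$ is an integer. A function $g\in C^\infty((0,\infty))$ is completely monotonic if $(-1)^ng^{(n)}(x)\geq 0$ for all $n\geq 0$ and all $x>0$. For $\lambda>0$, $k\geq 0$ and $f\in C^\infty((0,\infty))$, $c_k^{\lambda}(f)(x)=x^{1-\lambda}\left(x^{\lambda-1+k}f(x)\right)^{(k)}$, where $^{(k)}$ denotes the $k$-th derivative. The class $\mathcal C_N^\lambda$ is the set of $f\in C^\infty((0,\infty))$ such that $c_k^\lambda(f)$ is completely monotonic for $k=0,\ldots,N$. Distributions are on $(0,\infty)$, with test functions the infinitely often differentiable functions of compact support in $(0,\infty)$. The action of a distribution $u$ on a test function $\varphi$ is denoted $\langle u,\varphi\rangle$; a measure $\mu$ acts by $\langle\mu,\varphi\rangle=\int\varphi\,d\mu$; $\partial u$ is defined by $\langle\partial u,\varphi\rangle=-\langle u,\varphi'\rangle$, and $\langle s^ku,\varphi\rangle=\langle u,s^k\varphi\rangle$.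
   Formalization: The final formula is proved with the added term c·λ(λ+1)…(λ+k−1) on the right-hand side; as printed it fails when c>0 (e.g. f≡c, μ=0, k=0), and for c=0 the two formulas agree. *)

(* Defs.v *)
From HB Require Import structures.
From mathcomp Require Import all_boot all_order all_algebra.
From mathcomp Require Import all_classical all_reals all_analysis.

Set Implicit Arguments.
Unset Strict Implicit.
Unset Printing Implicit Defensive.

Import Order.TTheory GRing.Theory Num.Theory.
Import numFieldNormedType.Exports.

Local Open Scope classical_set_scope.
Local Open Scope ring_scope.

(* Functions on (0, oo) are total functions R -> R of which only the values on
   (0, oo) are used; as (0, oo) is open, the iterated derivatives derive1n n g at
   points of (0, oo) depend only on these values. *)

Definition smooth_on (R : realType) (A : set R) (g : R -> R) : Prop :=
  forall (n : nat) (x : R), A x -> derivable (derive1n n g) x 1.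

Definition completely_monotonic (R : realType) (g : R -> R) : Prop :=
  smooth_on `]0, +oo[ g /\
  forall (n : nat) (x : R), 0 < x -> 0 <= (-1) ^+ n * derive1n n g x.

Definition ck (R : realType) (lambda : R) (k : nat) (f : R -> R) (x : R) : R :=
  x `^ (1 - lambda) *
  derive1n k (fun y : R => y `^ (lambda - 1 + k%:R) * f y) x.

Definition class_C (R : realType) (lambda : R) (N : nat) (f : R -> R) : Prop :=
  smooth_on `]0, +oo[ f /\
  forall k : nat, (k <= N)%N -> completely_monotonic (ck lambda k f).

(* Test functions on (0, oo), extended by zero to R. *)
Definition test_function (R : realType) (phi : R -> R) : Prop :=
  let supp := closure [set x | phi x != 0] in
  [/\ smooth_on setT phi, compact supp & supp `<=` `]0, +oo[].

(* A distribution is represented by its action on functions; only its values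
   on test functions are meaningful. *)
Definition distr (R : realType) := (R -> R) -> R.

Definition distr_eq (R : realType) (u v : distr R) : Prop :=
  forall phi : R -> R, test_function phi -> u phi = v phi.

Definition distr_deriv (R : realType) (u : distr R) : distr R :=
  fun phi => - u (derive1 phi).

Definition distr_mulX (R : realType) (k : nat) (u : distr R) : distr R :=
  fun phi => u (fun s => s ^+ k * phi s).

Definition distr_scale (R : realType) (a : R) (u : distr R) : distr R :=
  fun phi => a * u phi.

Definition distr_of_measure (R : realType)
    (mu : {measure set (measurableTypeR R) -> \bar R}) : distr R :=
  fun phi => \int[mu]_(s in `]0, +oo[) phi s.

(* A positive measure on (0, oo), extended by zero to R. It is finite on
   compact subsets of (0, oo), so that it acts on test functions. *)
Definition pos_measure (R : realType)
    (mu : {measure set (measurableTypeR R) -> \bar R}) : Prop :=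
  mu `]-oo, 0]%classic = 0%E /\
  forall K : set R, compact K -> K `<=` `]0, +oo[ -> (mu K < +oo)%E.

(* nu is the positive measure (-1)^k s^k d^k mu. *)
Definition is_mu_k (R : realType) (k : nat)
    (mu nu : {measure set (measurableTypeR R) -> \bar R}) : Prop :=
  pos_measure nu /\
  distr_eq (distr_of_measure nu)
    (distr_scale ((-1) ^+ k)
      (distr_mulX k (iter k (@distr_deriv R) (distr_of_measure mu)))).

Definition laplace (R : realType) (lambda : R)
    (mu : {measure set (measurableTypeR R) -> \bar R}) (x : R) : \bar R :=
  (\int[mu]_(s in `]0%R, +oo[) (expR (- (x * s)) * s `^ (lambda - 1))%:E)%E.

Definition representation (R : realType) (lambda : R) (N : nat) (f : R -> R)
    (c : R) (mu : {measure set (measurableTypeR R) -> \bar R}) : Prop :=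
  [/\ 0 <= c,
      pos_measure mu,
      forall x : R, 0 < x -> (f x)%:E = (c%:E + laplace lambda mu x)%E
    & forall k : nat, (k <= N)%N ->
        exists nu : {measure set (measurableTypeR R) -> \bar R},
          is_mu_k k mu nu /\
          forall x : R, 0 < x -> (laplace lambda nu x < +oo)%E].

Definition rising (R : realType) (a : R) (k : nat) : R :=
  \prod_(i < k) (a + i%:R).

(* Main.v *)
(**
With theta = x d/dx, c_{k+1}(f) = (theta + lambda + k) c_k(f), and correspondingly
<mu_{k+1}, phi> = <mu_k, s phi' + (k+1) phi>; so everything reduces to one Euler step.

From (a) to (b): if g is completely monotonic, its Taylor expansion at a = m+1
converges to g on (0, a), and substituting x -> a (1 - exp (- x / a)) turns it into
the Laplace transform of the discrete measure with mass (-a)^n g^(n)(a) / n! at n / a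
(Feller's proof of Bernstein's theorem).  The limit, along an ultrafilter, of the
distribution functions of these measures defines a Stieltjes measure of which g is the
Laplace transform.  For h = (theta + a') g the masses satisfy
w'_n = (n + a') w_n - (n + 1) w_{n+1}, and a summation by parts gives, in the limit,
<alpha_h, psi> = <alpha_g, s psi' + a' psi>.  Finally mu_k = s^(1 - lambda) alpha_k.

From (b) to the formula: the distributional identity is tested on
exp (- x s) s^(lambda - 1) chi_n(s) with smooth cutoffs chi_n for which s chi_n' tends
to 0 boundedly by a multiple of 1 + s, and dominated convergence yields
L mu_{k+1} = (theta + lambda + k) (L mu_k) for the transform L of the statement.
*)

(* The obstacle in the first direction is that the measures attached to different c_k(f) must be
   comparable. They are all limits along one and the same ultrafilter, so the exact relation between
   the discrete masses of g and of h passes to the limit; limits along unrelated subsequences could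
   not be compared in this way. The factor s^(1 - lambda) turns the coefficient lambda + k of the
   Euler step into the k + 1 of the distributional recursion, which therefore does not involve
   lambda.

   The atom of alpha_g at 0 is invisible to test functions. For k = 0 it becomes the constant c. On
   constants, theta + lambda + k is multiplication by lambda + k, so c_k(c) = c lambda (lambda + 1)
   ... (lambda + k - 1); this is the term [c * rising lambda k] in the final formula.

   In the converse direction mu_k is known only through its action on test functions. The hypothesis
   provides one measure with finite transform, whereas the formula concerns any measure representing
   mu_k; hence the transform is first shown to depend on that action alone. *)
Require Import Defs.
From HB Require Import structures.
From mathcomp Require Import all_boot all_order all_algebra.
From mathcomp Require Import all_classical all_reals all_analysis.
From mathcomp Require Import measurable_realfun ring lra.

Import Order.TTheory GRing.Theory Num.Theory.
Import numFieldNormedType.Exports.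

Local Open Scope classical_set_scope.
Local Open Scope ring_scope.

(** * Smooth functions *)

(* The library states these rules for the operations of the ring of functions,
   which do not unify with pointwise expressions. *)
Section PointwiseDerivatives.
Context {R : realType}.
Implicit Types (f g : R -> R) (x df dg c : R).

Lemma isder_eq {f x df} dg : is_derive x 1 f df -> df = dg -> is_derive x 1 f dg.
Proof. by move=> + <-. Qed.

Lemma isder_cst c x : is_derive x 1 (fun=> c) 0.
Proof. exact: is_derive_cst. Qed.

Lemma isder_id x : is_derive x 1 (fun z => z) 1.
Proof. exact: is_derive_id. Qed.

Lemma isder_add {f g x df dg} : is_derive x 1 f df -> is_derive x 1 g dg ->
  is_derive x 1 (fun z => f z + g z) (df + dg).
Proof. by move=> ? ?; exact: is_deriveD. Qed.

Lemma isder_sub {f g x df dg} : is_derive x 1 f df -> is_derive x 1 g dg ->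
  is_derive x 1 (fun z => f z - g z) (df - dg).
Proof. by move=> ? ?; exact: is_deriveB. Qed.

Lemma isder_scale c {f x df} : is_derive x 1 f df ->
  is_derive x 1 (fun z => c * f z) (c * df).
Proof. by move=> ?; exact: is_deriveZ. Qed.

Lemma isder_mul {f g x df dg} : is_derive x 1 f df -> is_derive x 1 g dg ->
  is_derive x 1 (fun z => f z * g z) (df * g x + f x * dg).
Proof.
move=> du dv; apply: isder_eq (is_deriveM du dv) _.
by rewrite /GRing.scale/= addrC [g x * _]mulrC.
Qed.

Lemma isder_exp {f x df} n : is_derive x 1 f df ->
  is_derive x 1 (fun z => f z ^+ n.+1) (n.+1%:R * f x ^+ n * df).
Proof.
move=> du; have -> : (fun z => f z ^+ n.+1) = f ^+ n.+1.
  by apply/funext => z; rewrite fctE.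
exact: is_deriveX.
Qed.

Lemma isder_inv {f x df} : f x != 0 -> is_derive x 1 f df ->
  is_derive x 1 (fun z => (f z)^-1) (- ((f x)^-1 ^+ 2 * df)).
Proof.
move=> f0 du; apply: isder_eq (is_deriveV f0 du) _.
by rewrite /GRing.scale/= exprVn mulNr.
Qed.

Lemma isder_comp {f g x df dg} : is_derive (g x) 1 f df -> is_derive x 1 g dg ->
  is_derive x 1 (fun z => f (g z)) (df * dg).
Proof. exact: is_derive1_comp. Qed.

End PointwiseDerivatives.

Section Smooth.
Context {R : realType}.
Implicit Types (A : set R) (f g h : R -> R) (x : R).

Lemma is_derive_derive1n {A g} n {x} : smooth_on A g -> A x ->
  is_derive x 1 (derive1n n g) (derive1n n.+1 g x).
Proof. by move=> sg Ax; rewrite derive1nS derive1E; apply/derivableP/sg. Qed.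

Lemma is_derive_eq_on {A f g x} (df : R) : open A -> {in A, f =1 g} -> A x ->
  is_derive x 1 f df -> is_derive x 1 g df.
Proof.
move=> oA fg Ax; apply: near_eq_is_derive.
have := open_nbhs_nbhs (conj oA Ax); apply: filterS => y Ay.
by apply: fg; rewrite inE.
Qed.

Lemma derive1n_eq_on {A f g} n : open A -> {in A, f =1 g} ->
  {in A, derive1n n f =1 derive1n n g}.
Proof.
move=> oA fg; elim: n => [//|n IHn] x /[!inE] Ax.
rewrite !derive1nS !derive1E; apply: near_eq_derive.
have := open_nbhs_nbhs (conj oA Ax); apply: filterS => y Ay.
by apply: IHn; rewrite inE.
Qed.

Lemma smooth_on_eq {A f g} : open A -> {in A, f =1 g} ->
  smooth_on A f -> smooth_on A g.
Proof.
move=> oA fg sf n x Ax; apply: near_eq_derivable (sf n x Ax).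
have := open_nbhs_nbhs (conj oA Ax); apply: filterS => y Ay.
by apply: (derive1n_eq_on n oA fg); rewrite inE.
Qed.

(** Coinduction principle: a class of functions closed under derivation contains only smooth
    functions. It gives smoothness of products, powers and exponentials without a formula for the
    n-th derivative. *)
Lemma smooth_on_coind {A} (C : set (R -> R)) : open A ->
  (forall h, C h -> exists2 h', C h' &
    forall x, A x -> is_derive x 1 h (h' x)) ->
  forall h, C h -> smooth_on A h.
Proof.
move=> oA CP h Ch n.
have [hn Chn hnE] : exists2 hn, C hn & {in A, hn =1 derive1n n h}.
  elim: n => [|n [hn /CP[h' Ch' dh'] hnE]]; first by exists h.
  exists h' => // x /[!inE] Ax; rewrite derive1nS derive1E.
  by have [_ <-] := is_derive_eq_on _ oA hnE Ax (dh' _ Ax).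
have [h' _ dh'] := CP _ Chn => x Ax.
by have [] := is_derive_eq_on _ oA hnE Ax (dh' _ Ax).
Qed.

Lemma derive1n_unique {A} (G : nat -> R -> R) : open A ->
  (forall n x, A x -> is_derive x 1 (G n) (G n.+1 x)) ->
  forall n, {in A, derive1n n (G 0%N) =1 G n}.
Proof.
move=> oA dG; elim=> [//|n IHn] x /[!inE] Ax; rewrite derive1nS derive1E.
have IH' : {in A, G n =1 derive1n n (G 0%N)} by move=> y /IHn.
by have [_ <-] := is_derive_eq_on _ oA IH' Ax (dG _ _ Ax).
Qed.

Lemma smooth_on_derive1 {A g} : smooth_on A g -> smooth_on A (derive1 g).
Proof. by move=> sg n x Ax; rewrite -derive1Sn; exact: sg. Qed.

Lemma smooth_on_is_derive {A g x} : smooth_on A g -> A x ->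
  is_derive x 1 g ((derive1 g) x).
Proof. by move=> sg Ax; apply: (is_derive_derive1n 0 sg). Qed.

Lemma smooth_onS {A B g} : A `<=` B -> smooth_on B g -> smooth_on A g.
Proof. by move=> AB sg n x /AB; exact: sg. Qed.

Lemma smooth_onU {A B g} : smooth_on A g -> smooth_on B g ->
  smooth_on (A `|` B) g.
Proof. by move=> sA sB n x [/sA|/sB]; exact. Qed.

Lemma smooth_on_continuous {A g x} : smooth_on A g -> A x ->
  {for x, continuous g}.
Proof.
by move=> sg /(sg 0%N) /derivable1_diffP; exact: differentiable_continuous.
Qed.

Lemma smooth_on_cst A (c : R) : open A -> smooth_on A (cst c).
Proof.
move=> oA; apply: (smooth_on_coind (range (@cst R R))) => //.
by move=> _ [d _ <-]; exists (cst 0) => [|x _]; [exists 0|exact: is_derive_cst].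
Qed.

Lemma smooth_onD {A f g} : open A -> smooth_on A f -> smooth_on A g ->
  smooth_on A (fun x => f x + g x).
Proof.
move=> oA sf sg.
pose C := [set h | exists f g, [/\ smooth_on A f, smooth_on A g &
  h = fun x => f x + g x]].
apply: (smooth_on_coind C) => //; last by exists f, g.
move=> _ [u [v [su sv ->]]]; exists (fun x => (derive1 u) x + (derive1 v) x).
  exists (derive1 u), (derive1 v).
  by split; [apply: smooth_on_derive1 su|apply: smooth_on_derive1 sv|].
move=> x Ax; have := smooth_on_is_derive su Ax.
by have := smooth_on_is_derive sv Ax => dv du; exact: isder_add.
Qed.

(** Products of smooth functions are not closed under derivation, but by Leibniz's rule their finite
    sums are; this is the class to which [smooth_on_coind] is applied. *)
Inductive product_sum A : (R -> R) -> Prop :=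
| ProductSum1 f g : smooth_on A f -> smooth_on A g ->
    product_sum A (fun x => f x * g x)
| ProductSumD f g : product_sum A f -> product_sum A g ->
    product_sum A (fun x => f x + g x).

Lemma smooth_onM {A f g} : open A -> smooth_on A f -> smooth_on A g ->
  smooth_on A (fun x => f x * g x).
Proof.
move=> oA sf sg; apply: (smooth_on_coind (product_sum A)) => //; last first.
  exact: ProductSum1.
move=> h; elim=> {h} [u v su sv|u v _ [u' Cu' du] _ [v' Cv' dv]]; last first.
  exists (fun x => u' x + v' x); first exact: ProductSumD.
  by move=> x Ax; exact: isder_add (du _ Ax) (dv _ Ax).
exists (fun x => u x * (derive1 v) x + (derive1 u) x * v x) => [|x Ax].
  apply: ProductSumD.
    exact: ProductSum1 su (smooth_on_derive1 sv).
  exact: ProductSum1 (smooth_on_derive1 su) sv.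
have := smooth_on_is_derive su Ax.
have := smooth_on_is_derive sv Ax => dv du.
by apply: is_derive_eq; rewrite /GRing.scale /= [v x * _]mulrC.
Qed.

Lemma smooth_on_id A : open A -> smooth_on A id.
Proof.
move=> oA; apply: (smooth_on_coind [set h | h = id \/ exists c, h = cst c]) => //.
  move=> _ [->|[c ->]]; first by exists (cst 1) => [|x _]; [right; exists 1|exact: is_derive_id].
  by exists (cst 0); [right; exists 0|move=> x _; exact: is_derive_cst].
by left.
Qed.

Lemma is_derive_powR (a x : R) : 0 < x ->
  is_derive x 1 (fun y => y `^ a) (a * x `^ (a - 1)).
Proof.
move=> x0; have xI : x \in `]0, +oo[ by rewrite in_itv/= x0.
by rewrite -(powR_derive1 a xI) derive1E; apply/derivableP/derivable_powR.
Qed.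

Lemma smooth_on_powR (a : R) : smooth_on `]0, +oo[ (fun x => x `^ a).
Proof.
apply: (smooth_on_coind [set h | exists c b : R, h = fun x => c * x `^ b]) => //.
  move=> _ [c [b ->]]; exists (fun x => (c * b) * x `^ (b - 1)).
    by exists (c * b), (b - 1).
  move=> x /=; rewrite in_itv/= andbT => /(is_derive_powR b) d.
  by apply: is_derive_eq; rewrite /GRing.scale /= mulrA.
by exists 1, a; apply/funext => x; rewrite mul1r.
Qed.

Lemma is_derive_expRM (c x : R) :
  is_derive x 1 (fun y => expR (c * y)) (c * expR (c * x)).
Proof.
by apply: is_derive_eq; rewrite /GRing.scale /= mulr1 mulrC.
Qed.

Lemma smooth_on_expRM A (c : R) : open A ->
  smooth_on A (fun x => expR (c * x)).
Proof.
move=> oA.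
apply: (smooth_on_coind [set h | exists d : R, h = fun x => d * expR (c * x)]).
- by [].
- move=> _ [d ->]; exists (fun x => (d * c) * expR (c * x)).
    by exists (d * c).
  move=> x _; have := is_derive_expRM c x => e.
  by apply: is_derive_eq; rewrite /GRing.scale /= mulrA.
- by exists 1; apply/funext => x; rewrite mul1r.
Qed.

End Smooth.

(** * Taylor expansion of completely monotonic functions *)

Lemma antitone_on_segment {R : realType} {g : R -> R} (g' : R -> R) {b a : R} :
  (forall x, b <= x <= a -> is_derive x 1 g (g' x)) ->
  (forall x, b <= x <= a -> g' x <= 0) -> b <= a -> g a <= g b.
Proof.
move=> dg g'0 ba.
have dg' x : x \in `[b, a] -> is_derive x 1 g (g' x).
  by rewrite in_itv/=; exact: dg.
have dgo x : x \in `]b, a[ -> is_derive x 1 g (g' x).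
  by move=> /subset_itv_oo_cc; exact: dg'.
have cg : {within `[b, a], continuous g}.
  by apply: derivable_within_continuous => x /dg'[].
have [c cI e] := MVT_segment ba dgo cg.
by rewrite -subr_le0 e mulr_le0_ge0 ?subr_ge0// g'0.
Qed.

(* [S j] plays the role of the alternating derivative (-1)^j g^(j). *)
Section MonotoneTaylor.
Context {R : realType}.
Variable S : nat -> R -> R.
Hypothesis dS : forall j (x : R), 0 < x -> is_derive x 1 (S j) (- S j.+1 x).
Hypothesis S_ge0 : forall j x, 0 < x -> 0 <= S j x.

(** Remainder of order n in the Taylor expansion of [S j] at a. As the k-th derivative of [S j] is
    (-1)^k [S (j + k)], the expansion in powers of a - y has nonnegative coefficients. *)
Let rem n j a y : R :=
  S j y - \sum_(k < n) S (j + k)%N a * ((a - y) ^+ k / k`!%:R).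

Lemma is_derive_taylor_monomial k (a y : R) :
  is_derive y 1 (fun z => (a - z) ^+ k.+1 / k.+1`!%:R) (- ((a - y) ^+ k / k`!%:R)).
Proof.
have d0 := isder_sub (isder_cst a y) (isder_id y).
apply: isder_eq (isder_mul (isder_exp k d0) (isder_cst k.+1`!%:R^-1 y)) _.
rewrite factS natrM; field.
by rewrite pnatr_eq0 -lt0n fact_gt0 nat1r pnatr_eq0.
Qed.


Lemma remS n j a (y : R) :
  rem n.+1 j a y = rem n j a y - S (j + n)%N a * ((a - y) ^+ n / n`!%:R).
Proof. by rewrite /rem big_ord_recr/= opprD addrA. Qed.

Lemma is_derive_rem n j (a y : R) : 0 < y ->
  is_derive y 1 (rem n.+1 j a) (- rem n j.+1 a y).
Proof.
move=> y0; have dSj := dS j _ y0; elim: n => [|n IHn].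
  have -> : rem 1 j a = fun z => S j z - S j a.
    by apply/funext => z; rewrite /rem big_ord1 expr0 fact0 divr1 mulr1 addn0.
  apply: isder_eq (isder_sub dSj (isder_cst (S j a) y)) _.
  by rewrite /rem big_ord0 !subr0.
have -> : rem n.+2 j a =
    fun z => rem n.+1 j a z - S (j + n.+1)%N a * ((a - z) ^+ n.+1 / n.+1`!%:R).
  by apply/funext => z; rewrite remS.
have dm := is_derive_taylor_monomial n a y.
apply: isder_eq (isder_sub IHn (isder_scale (S (j + n.+1)%N a) dm)) _.
by rewrite remS addnS addSn; ring.
Qed.

Lemma rem_center n j a : rem n.+1 j a a = 0.
Proof.
rewrite /rem big_ord_recl/= subrr expr0 fact0 divr1 mulr1 addn0.
rewrite big1 ?addr0 ?subrr// => i _.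
by rewrite /bump/= add1n expr0n/= mul0r mulr0.
Qed.

(** The remainder of order n + 1 vanishes at a, and its derivative is minus a remainder of order n,
    which is nonpositive by induction. *)
Lemma rem_ge0 n j (a y : R) : 0 < y <= a -> 0 <= rem n j a y.
Proof.
elim: n j y => [|n IHn] j y /andP[y0 ya].
  by rewrite /rem big_ord0 subr0; exact: S_ge0.
rewrite -(rem_center n j a); apply: (antitone_on_segment _ _ _ ya) => x /andP[yx xa].
  by apply: is_derive_rem; exact: lt_le_trans yx.
by rewrite oppr_le0 IHn// xa (lt_le_trans y0 yx).
Qed.

(** In integral form, [rem n.+1 j a y] is the integral over [y, a] of (t - y)^n / n! times
    [S (j + n.+1)] at t, and the claim is t - y <= a - y under the integral. The proof is an
    induction on derivatives: the difference of the two sides vanishes at a, and its derivative is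
    minus the same difference for n - 1 and j + 1. *)
Lemma rem_euler n j (a y : R) : 0 < y <= a ->
  n%:R * rem n.+1 j a y <= (a - y) * rem n j.+1 a y.
Proof.
elim: n j y => [|n IHn] j y /andP[y0 ya].
  by rewrite mul0r; apply: mulr_ge0; [rewrite subr_ge0|apply: rem_ge0; rewrite y0].
rewrite -subr_ge0.
pose G z := (a - z) * rem n.+1 j.+1 a z - n.+1%:R * rem n.+2 j a z.
have <- : G a = 0 by rewrite /G !rem_center !mulr0 subrr.
pose G' z := - ((a - z) * rem n j.+2 a z - n%:R * rem n.+1 j.+1 a z).
apply: (antitone_on_segment G' _ _ ya) => x /andP[yx xa].
  have x0 := lt_le_trans y0 yx.
  have d1 := is_derive_rem n j.+1 a _ x0; have d2 := is_derive_rem n.+1 j a _ x0.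
  have d0 := isder_sub (isder_cst a x) (isder_id x).
  apply: isder_eq (isder_sub (isder_mul d0 d1) (isder_scale n.+1%:R d2)) _.
  by rewrite /G' -natr1; ring.
by rewrite oppr_le0 subr_ge0 IHn// xa (lt_le_trans y0 yx).
Qed.

(* By [rem_euler], the derivative of [rem n.+1 j a x / (a - x) ^+ n] is <= 0. *)
Lemma rem_ratio n j (a z y : R) : 0 < z -> z <= y -> y < a ->
  rem n.+1 j a y / (a - y) ^+ n <= rem n.+1 j a z / (a - z) ^+ n.
Proof.
move=> z0 zy ya.
pose g' x := (a - x)^-1 ^+ n.+1 * (n%:R * rem n.+1 j a x - (a - x) * rem n j.+1 a x).
rewrite -!exprVn.
apply: (@antitone_on_segment _ (fun x => rem n.+1 j a x * (a - x)^-1 ^+ n) g' _ _ _ _ zy)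
  => x /andP[zx xy].
  have x0 := lt_le_trans z0 zx.
  have xa : a - x != 0 by rewrite subr_eq0 gt_eqF// (le_lt_trans xy).
  have d1 := is_derive_rem n j a _ x0.
  have dV := @isder_inv R (fun w => a - w) x _ xa (isder_sub (isder_cst a x) (isder_id x)).
  move: d1; rewrite /g'; case: (n) => [|m] d1.
    under eq_fun do rewrite expr0 mulr1.
    apply: isder_eq d1 _.
    by rewrite expr1 mul0r sub0r mulrN mulrA mulVf// mul1r.
  apply: isder_eq (isder_mul d1 (isder_exp m dV)) _.
  by rewrite !exprS; field.
have x0 := lt_le_trans z0 zx.
rewrite /g' pmulr_rle0 ?exprn_gt0 ?invr_gt0 ?subr_gt0 ?(le_lt_trans xy)//.
by rewrite subr_le0 rem_euler// x0 (ltW (le_lt_trans xy ya)).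
Qed.

(** By [rem_ratio] the remainder at y is at most q^n times the remainder at a smaller point z, with
    q = (a - y) / (a - z) < 1, and the remainder at z is at most [S 0 z] because the subtracted
    terms are nonnegative. *)
Lemma taylor_cvg (a y : R) : 0 < y -> y < a ->
  \sum_(k < n) S k a * ((a - y) ^+ k / k`!%:R) @[n --> \oo] --> S 0%N y.
Proof.
(* Any point strictly between 0 and y would do. *)
move=> y0 ya; pose z := y / 2.
have z0 : 0 < z by rewrite divr_gt0.
have zy : z < y by rewrite /z; lra.
have az0 : 0 < a - z by lra.
pose q := (a - y) / (a - z).
have q0 : 0 <= q by rewrite divr_ge0; lra.
have q1 : `|q| < 1 by rewrite ger0_norm// ltr_pdivrMr//; lra.
have remE n : S 0%N y - rem n 0 a y = \sum_(k < n) S k a * ((a - y) ^+ k / k`!%:R).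
  by rewrite /rem opprB addrC subrK.
have r0 : rem n 0 a y @[n --> \oo] --> 0.
  rewrite -(cvg_shiftn 1); under eq_fun do rewrite addn1.
  have qS : q ^+ n * S 0%N z @[n --> \oo] --> 0.
    by rewrite -(mul0r (S 0%N z)); apply: cvgMl; exact: cvg_expr.
  apply: (@squeeze_cvgr _ _ _ _ (cst 0) _ _ _ _ _ qS); last exact: cvg_cst.
  apply/nearW => n; rewrite rem_ge0 ?y0 ?(ltW ya)//=.
  have := rem_ratio n 0 a _ _ z0 (ltW zy) ya.
  rewrite ler_pdivrMr ?exprn_gt0 ?subr_gt0// => /le_trans; apply.
  rewrite mulrAC -mulrA -expr_div_n mulrC; apply: ler_wpM2l.
    exact: exprn_ge0.
  rewrite /rem gerBl; apply: sumr_ge0 => k _.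
  rewrite mulr_ge0 ?divr_ge0 ?exprn_ge0 ?(ltW az0)// S_ge0//; lra.
under eq_fun do rewrite -remE.
by have := cvgB (@cvg_cst _ (S 0%N y) _ \oo _) r0; rewrite subr0; apply.
Qed.

End MonotoneTaylor.

(** * Integrals approximated through distribution functions on a mesh *)

Lemma measurable_EFinR {R : realType} {D : set (measurableTypeR R)}
    {g : R -> R} :
  measurable_fun D (g : measurableTypeR R -> R) ->
  measurable_fun D (EFin \o g : measurableTypeR R -> \bar R).
Proof. by move=> mg; exact/(@measurable_EFinP _ (measurableTypeR R)). Qed.

Definition below {R : realType} (t s : R) : R := (s <= t)%R%:R.

Lemma below1 {R : realType} (t s : R) : s <= t -> below t s = 1.
Proof. by rewrite /below => ->. Qed.

Lemma below0 {R : realType} (t s : R) : t < s -> below t s = 0.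
Proof. by rewrite /below => /lt_geF ->. Qed.

Lemma below_ge0 {R : realType} (t s : R) : 0 <= below t s.
Proof. exact: ler0n. Qed.

Lemma measurable_below {R : realType} (t : R) (D : set (measurableTypeR R)) :
  measurable_fun D (below t : measurableTypeR R -> R).
Proof.
have -> : below t = \1_(`]-oo, t]%classic).
  by apply/funext => s; rewrite indicE mem_setE/= in_itv.
exact: measurable_indic.
Qed.

Section BoundedSupport.
Context {R : realType}.
Variables (mu : {measure set (measurableTypeR R) -> \bar R}) (T : R).
Hypothesis muT : (mu `[0%R, T]%classic < +oo)%E.

Lemma integral_below t :
  (\int[mu]_(s in `[0%R, +oo[) (below t s)%:E)%E = mu `[0%R, t]%classic.
Proof.
transitivity (\int[mu]_(s in `[0%R, +oo[) (\1_(`]-oo, t]%classic) s)%:E)%E.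
  by apply: eq_integral => s _; rewrite indicE mem_setE/= in_itv.
rewrite integral_indic//; congr (mu _).
apply/seteqP; split=> x; rewrite /= !in_itv/= andbT; last by case/andP.
by case=> -> ->.
Qed.

Lemma integrable_below : mu.-integrable `[0, +oo[ (EFin \o below T).
Proof.
apply/integrableP; split; first exact: (measurable_EFinR (measurable_below T _)).
rewrite (eq_integral (fun s : measurableTypeR R => (below T s)%:E)).
  by rewrite integral_below.
by move=> s _; rewrite /= ger0_norm ?below_ge0.
Qed.

Lemma integrable_bounded_support (h : R -> R) (M : R) :
  measurable_fun (`[0, +oo[%classic : set (measurableTypeR R)) h ->
  (forall s, 0 <= s -> `|h s| <= M * below T s) ->
  mu.-integrable `[0, +oo[ (EFin \o h).
Proof.
move=> mh hM; have mD : measurable (`[0, +oo[%classic : set (measurableTypeR R)) by [].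
apply: (le_integrable mD _ _ (integrableZl mD M integrable_below)).
  exact: measurable_EFinR.
move=> s /=; rewrite in_itv/= andbT => s0.
by rewrite lee_fin (le_trans (hM s s0))// ler_norm.
Qed.

End BoundedSupport.

Section StepApproximation.
Context {R : realType}.
Variables (psi : R -> R) (T L : R) (p : nat).
Hypothesis T_gt0 : 0 < T.
Hypothesis p_gt0 : (0 < p)%N.
Hypothesis lip : forall s t : R, 0 <= s -> 0 <= t ->
  `|psi s - psi t| <= L * `|s - t|.
Hypothesis psi0 : forall s, T <= s -> psi s = 0.

Definition mesh_point (i : nat) : R := i%:R * (T / p%:R).
Definition mesh_drop (i : nat) : R := psi (mesh_point i) - psi (mesh_point i.+1).

Lemma mesh_ge0 : 0 <= T / p%:R.
Proof. by rewrite divr_ge0// ltW. Qed.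

Lemma mesh_point_ge0 i : 0 <= mesh_point i.
Proof. by rewrite mulr_ge0// mesh_ge0. Qed.

Lemma mesh_point_last : mesh_point p = T.
Proof. by rewrite /mesh_point mulrC divfK// pnatr_eq0 -lt0n. Qed.

Lemma mesh_pointS i : mesh_point i.+1 = mesh_point i + T / p%:R.
Proof. by rewrite /mesh_point -natr1 mulrDl mul1r. Qed.

Lemma mesh_point_le i j : (i <= j)%N -> mesh_point i <= mesh_point j.
Proof. by move=> ij; rewrite ler_wpM2r ?mesh_ge0// ler_nat. Qed.

Lemma mesh_drop_le i : `|mesh_drop i| <= L * (T / p%:R).
Proof.
rewrite (le_trans (lip _ _ (mesh_point_ge0 _) (mesh_point_ge0 _)))//.
by rewrite mesh_pointS opprD addNKr normrN ger0_norm// mesh_ge0.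
Qed.

Lemma sum_mesh_drop j n :
  \sum_(i < n) mesh_drop i * (j <= i)%N%:R =
  if (j <= n)%N then psi (mesh_point j) - psi (mesh_point n) else 0.
Proof.
elim: n => [|n IHn].
  by rewrite big_ord0 leqn0; case: eqP => [->|//]; rewrite subrr.
rewrite big_ord_recr/= IHn [(j <= n.+1)%N]leq_eqVlt ltnS.
have [jn|nj] := leqP j n; first by rewrite orbT mulr1 /mesh_drop addrA subrK.
rewrite mulr0 addr0 orbF; case: eqP => [->|//]; by rewrite subrr.
Qed.

(** The sum telescopes to the value of psi at the first mesh point to the right of s, because psi
    vanishes at T; that point is within one mesh length of s. *)
Lemma step_approx (s : R) : 0 <= s ->
  `|psi s - \sum_(i < p) mesh_drop i * below (mesh_point i) s|
  <= L * (T / p%:R) * below T s.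
Proof.
move=> s0; have [sT|Ts] := leP s T; last first.
  rewrite (psi0 _ (ltW Ts)) (below0 _ _ Ts) big1 ?subr0 ?normr0 ?mulr0// => i _.
  have iT : mesh_point i <= T.
    by rewrite -[leRHS]mesh_point_last mesh_point_le// ltnW.
  by rewrite below0 ?mulr0// (le_lt_trans iT Ts).
have ex : exists j, s <= mesh_point j by exists p; rewrite mesh_point_last.
have [j sj jmin] := ex_minnP ex.
have jp : (j <= p)%N by apply: jmin; rewrite mesh_point_last.
have jE i : below (mesh_point i) s = (j <= i)%N%:R.
  rewrite /below; congr (_%:R); congr nat_of_bool.
  by apply/idP/idP => [/jmin//|ij]; rewrite (le_trans sj)// mesh_point_le.
under eq_bigr do rewrite jE.
rewrite sum_mesh_drop jp mesh_point_last (psi0 T)// subr0 below1// mulr1.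
have L_ge0 : 0 <= L.
  have := lip 0 1 (lexx _) ler01; rewrite sub0r normrN1 mulr1.
  exact: le_trans.
rewrite (le_trans (lip _ _ s0 (mesh_point_ge0 _)))// ler_wpM2l//.
rewrite ler0_norm ?subr_le0// opprB.
case: j sj jmin {jp jE} => [sj _|j sj jmin].
  by rewrite /mesh_point mul0r sub0r (le_trans _ mesh_ge0)// oppr_le0.
rewrite lerBlDr mesh_pointS addrC lerD2l leNgt; apply/negP => js.
by have := jmin j (ltW js); rewrite ltnn.
Qed.

(** Only finitely many values of the distribution function of mu enter the approximating sum, so
    that pointwise convergence of distribution functions will suffice for convergence of
    integrals. *)
Lemma measure_step_approx (mu : {measure set (measurableTypeR R) -> \bar R}) :
  (mu `[0%R, T]%classic < +oo)%E ->
  measurable_fun (`[0, +oo[%classic : set (measurableTypeR R)) psi ->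
  `|(\int[mu]_(s in `[0, +oo[) psi s) -
    \sum_(i < p) mesh_drop i * fine (mu `[0, mesh_point i]%classic)|
  <= L * (T / p%:R) * fine (mu `[0, T]%classic).
Proof.
move=> muT mpsi.
have mD : measurable (`[0, +oo[%classic : set (measurableTypeR R)) by [].
have IE := integral_below mu; have int1 := integrable_below mu T muT.
have leInt := integrable_bounded_support mu T muT.
have intI t : t <= T ->
    mu.-integrable `[0, +oo[ (EFin \o below t).
  move=> tT; apply: (leInt _ 1 (measurable_below t _)) => s _.
  rewrite mul1r ger0_norm ?below_ge0//.
  have [st|ts] := leP s t; last by rewrite below0 ?below_ge0.
  by rewrite !below1// (le_trans st).
pose step (s : R) := \sum_(i < p) mesh_drop i * below (mesh_point i) s.
have itv_le (i : 'I_p) : mesh_point i <= T.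
  by rewrite -[leRHS]mesh_point_last mesh_point_le// ltnW.
have istep : mu.-integrable `[0, +oo[ (EFin \o step).
  have -> : EFin \o step =
      (fun s => \sum_(i < p) ((mesh_drop i)%:E * (below (mesh_point i) s)%:E))%E.
    by apply/funext => s; rewrite /= -sumEFin.
  by apply: integrable_sum => // i _; apply: integrableZl => //; exact: intI.
have Estep : \int[mu]_(s in `[0, +oo[) step s =
    \sum_(i < p) mesh_drop i * fine (mu `[0, mesh_point i]%classic).
  rewrite /Rintegral.
  rewrite (eq_integral (fun s : measurableTypeR R =>
    \sum_(i < p) ((mesh_drop i)%:E * (below (mesh_point i) s)%:E))%E); last first.
    by move=> s _; rewrite -sumEFin.
  rewrite integral_sum//; last by move=> i; apply: integrableZl => //; exact: intI.
  rewrite -sum_fine; last first.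
    by move=> i _; apply: integrable_fin_num => //; apply: integrableZl => //; exact: intI.
  apply: eq_bigr => i _; rewrite integralZl//; last exact: intI.
  by rewrite fineM ?IE// -IE; apply: integrable_fin_num => //; exact: intI.
have mstep : measurable_fun (`[0, +oo[%classic : set (measurableTypeR R)) step.
  exact: ((@measurable_EFinP _ (measurableTypeR R) _ _ _).1 (measurable_int _ istep)).
have mdiff : measurable_fun (`[0, +oo[%classic : set (measurableTypeR R))
    (fun s => psi s - step s).
  exact: measurable_funB.
have idiff := leInt _ _ mdiff step_approx.
have ipsi : mu.-integrable `[0, +oo[ (EFin \o psi).
  have -> : EFin \o psi = ((EFin \o (fun s => (psi s - step s)%R)) \+ (EFin \o step))%E.
    by apply/funext => s; rewrite /= -EFinD subrK.
  exact: integrableD.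
rewrite -Estep -RintegralB// (le_trans (le_normr_Rintegral _ _))//.
have -> : L * (T / p%:R) * fine (mu `[0, T]%classic) =
    \int[mu]_(s in `[0, +oo[) (L * (T / p%:R) * below T s).
  by rewrite RintegralZl// /Rintegral IE.
apply: le_Rintegral => //.
- exact: integrable_norm.
- exact: (integrableZl mD _ int1).
- by move=> s; rewrite /= in_itv/= andbT; exact: step_approx.
Qed.

End StepApproximation.

(** * Bernstein's theorem *)

Section FellerWeights.
Context {R : realType}.
Variable S : nat -> R -> R.
Hypothesis dS : forall j (x : R), 0 < x -> is_derive x 1 (S j) (- S j.+1 x).
Hypothesis S_ge0 : forall j (x : R), 0 < x -> 0 <= S j x.

Definition weight (m k : nat) : R := S k m.+1%:R * (m.+1%:R ^+ k / k`!%:R).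
Definition node (m k : nat) : R := k%:R / m.+1%:R.
Definition shifted (m : nat) (x : R) : R := m.+1%:R * (1 - expR (- (x / m.+1%:R))).

Lemma weight_ge0 m k : 0 <= weight m k.
Proof. by rewrite mulr_ge0 ?divr_ge0 ?exprn_ge0 ?S_ge0. Qed.

Lemma node_ge0 m k : 0 <= node m k.
Proof. by rewrite divr_ge0. Qed.

Lemma shifted_gt0 m (x : R) : 0 < x -> 0 < shifted m x.
Proof.
by move=> x0; rewrite mulr_gt0// subr_gt0 expR_lt1 oppr_lt0 divr_gt0.
Qed.

Lemma weight_series_cvg m (x : R) : 0 < x ->
  \sum_(k < n) weight m k * expR (- (x * node m k)) @[n --> \oo] --> S 0%N (shifted m x).
Proof.
move=> x0; have := taylor_cvg S dS S_ge0 m.+1%:R _ (shifted_gt0 m x x0).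
rewrite {1}/shifted gtr_pMr// ltrBlDr ltrDl expR_gt0 => /(_ isT).
have -> : m.+1%:R - shifted m x = m.+1%:R * expR (- (x / m.+1%:R)).
  by rewrite /shifted; ring.
under eq_fun do under eq_bigr do rewrite exprMn -expRM_natl.
suff e n : \sum_(k < n) S k m.+1%:R *
      (m.+1%:R ^+ k * expR (k%:R * - (x / m.+1%:R)) / k`!%:R) =
    \sum_(k < n) weight m k * expR (- (x * node m k)).
  by under eq_fun do rewrite e.
apply: eq_bigr => k _; rewrite /weight /node.
have -> : k%:R * - (x / m.+1%:R) = - (x * (k%:R / m.+1%:R)) :> R by ring.
ring.
Qed.

Lemma weight_series_le m (x : R) n : 0 < x ->
  \sum_(k < n) weight m k * expR (- (x * node m k)) <= S 0%N (shifted m x).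
Proof.
move=> x0; have cv := weight_series_cvg m x x0.
rewrite -(cvg_lim _ cv)//; apply: nondecreasing_cvgn_le.
  apply/nondecreasing_seqP => k; rewrite big_ord_recr/= lerDl.
  by rewrite mulr_ge0 ?weight_ge0// expR_ge0.
by apply/cvg_ex; eexists; exact: cv.
Qed.

Lemma shifted_cvg (x : R) : 0 < x -> shifted m x @[m --> \oo] --> x.
Proof.
move=> x0.
(* With t = x / (m + 1), this is 1 - t <= exp (- t) <= 1 - t + t^2, where the upper bound goes
   through exp (- t) <= 1 / (1 + t). *)
have bound m : x - x ^+ 2 * m.+1%:R^-1 <= shifted m x <= x.
  have t0 : 0 < x / m.+1%:R by rewrite divr_gt0.
  have xE : x = m.+1%:R * (x / m.+1%:R) by rewrite mulrC divfK.
  set t := x / m.+1%:R in t0 xE *.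
  have -> : x - x ^+ 2 * m.+1%:R^-1 = m.+1%:R * (t - t ^+ 2).
    by rewrite /t; field; rewrite addrC natr1 pnatr_eq0.
  rewrite /shifted -/t; apply/andP; split; last first.
    by rewrite [leRHS]xE ler_pM2l//; have := expR_ge1Dx (- t); lra.
  have e1 := expR_ge1Dx t; have e0 : 0 < expR t := expR_gt0 _.
  have : (expR t)^-1 <= (1 + t)^-1 by rewrite lef_pV2 ?posrE//; lra.
  have : (1 + t)^-1 <= 1 - t + t ^+ 2.
    rewrite -[leLHS]mul1r ler_pdivrMr; last lra.
    have -> : (1 - t + t ^+ 2) * (1 + t) = 1 + t ^+ 3 by ring.
    by rewrite lerDl exprn_ge0// ltW.
  rewrite ler_pM2l// expRN; lra.
have lo : x - x ^+ 2 * m.+1%:R^-1 @[m --> \oo] --> x.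
  have := cvgB (@cvg_cst _ x _ \oo _)
    (cvgM (@cvg_cst _ (x ^+ 2) _ \oo _) (@cvg_harmonic R)).
  by rewrite mulr0 subr0; apply.
exact: (squeeze_cvgr (nearW _ bound) lo (@cvg_cst _ x _ \oo _)).
Qed.

Lemma S0_shifted_cvg (x : R) : 0 < x -> S 0%N (shifted m x) @[m --> \oo] --> S 0%N x.
Proof.
move=> x0; apply: (@continuous_cvg _ _ _ \oo); last exact: shifted_cvg.
have [dx _] := dS 0%N x x0.
exact/differentiable_continuous/derivable1_diffP.
Qed.

(** Mass that the m-th discrete measure gives to [0, t]. The range stops just after the last node
    that can lie below t, so the sum is finite; [weight_cdfE] allows any longer range. *)
Definition weight_cdf (m : nat) (t : R) : R :=
  \sum_(k < (Num.truncn (m.+1%:R * t)).+1) weight m k * below t (node m k).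

Lemma weight_cdfE m (t : R) K : m.+1%:R * t < K%:R ->
  weight_cdf m t = \sum_(k < K) weight m k * below t (node m k).
Proof.
move=> tK; have out k : m.+1%:R * t < k%:R -> weight m k * below t (node m k) = 0.
  by move=> tk; rewrite below0 ?mulr0// ltr_pdivlMr// mulrC.
rewrite /weight_cdf; set K0 := (Num.truncn _).+1.
have tK0 : m.+1%:R * t < K0%:R by exact: truncnS_gt.
have trim a b : (a <= b)%N -> m.+1%:R * t < a%:R ->
    \sum_(k < b) weight m k * below t (node m k) =
    \sum_(k < a) weight m k * below t (node m k).
  move=> ab ta; rewrite -!(big_mkord xpredT (fun k => weight m k * below t (node m k))).
  rewrite (big_cat_nat (leq0n a) ab)/= [X in _ + X]big_nat_cond [X in _ + X]big1 ?addr0//.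
  move=> k /andP[/andP[ak _] _]; apply: out; rewrite (lt_le_trans ta)// ler_nat.
  exact: ak.
by have [/trim->//|/ltnW/trim->] := leqP K0 K.
Qed.

Lemma weight_cdf_ge0 m t : 0 <= weight_cdf m t.
Proof. by apply: sumr_ge0 => k _; rewrite mulr_ge0 ?weight_ge0 ?below_ge0. Qed.

Lemma weight_cdf_nd m s t : s <= t -> weight_cdf m s <= weight_cdf m t.
Proof.
move=> st; have mst : m.+1%:R * s <= m.+1%:R * t by rewrite ler_pM2l.
have tK : m.+1%:R * t < (Num.truncn (m.+1%:R * t)).+1%:R by exact: truncnS_gt.
rewrite (weight_cdfE _ _ _ (le_lt_trans mst tK)) (weight_cdfE _ _ _ tK).
apply: ler_sum => k _; apply: ler_wpM2l; first exact: weight_ge0.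
have [ks|sk] := leP (node m k) s; last by rewrite below0 ?below_ge0.
by rewrite !below1// (le_trans ks).
Qed.

Lemma weight_cdf_lt0 m t : t < 0 -> weight_cdf m t = 0.
Proof.
move=> t0; rewrite (weight_cdfE m t 0) ?big_ord0//.
by rewrite pmulr_rlt0.
Qed.

(** Chernoff's bound: the indicator of s <= t is at most exp (t - s), and the sum of the masses
    times exp (- s) is at most the transform at 1. Since [shifted m 1] converges, the bound is
    eventually uniform in m. *)
Lemma weight_cdf_le m t : weight_cdf m t <= expR t * S 0%N (shifted m 1).
Proof.
apply: le_trans (ler_wpM2l (expR_ge0 t) (weight_series_le m 1 _ ltr01)).
rewrite mulr_sumr; apply: ler_sum => k _; rewrite mulrCA -expRD mul1r.
apply: ler_wpM2l; first exact: weight_ge0.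
have [kt|tk] := leP (node m k) t; last by rewrite below0 ?expR_ge0.
by rewrite below1// -[leLHS]expR0 ler_expR; lra.
Qed.

End FellerWeights.

(** By compactness of [0, M] the image ultrafilter has a cluster point, and an ultrafilter converges
    to each of its cluster points. *)
Lemma ultra_bounded_cvg {R : realType} (U : set_system nat) (u : nat -> R) (M : R) :
  UltraFilter U -> (\forall m \near U, 0 <= u m <= M) -> cvg (u m @[m --> U]).
Proof.
move=> UU uM.
have [|l [_ cl]] := @segment_compact R 0 M (u @ U) _.
  by apply: filterS uM => m; rewrite /= in_itv.
apply/cvg_ex; exists l => B nB.
have [//|UnB] := in_ultra_setVsetC (u @^-1` B) UU.
have [y [/= nBy By]] := cl (~` B) B UnB nB.
by [].
Qed.

(** * The limit measure and weak convergence to it *)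

Section StieltjesLimit.
Context {R : realType}.
Variable U : set_system nat.
Hypothesis UU : UltraFilter U.
Hypothesis UN : \oo `<=` U.
Variable S : nat -> R -> R.
Hypothesis dS : forall j (x : R), 0 < x -> is_derive x 1 (S j) (- S j.+1 x).
Hypothesis S_ge0 : forall j (x : R), 0 < x -> 0 <= S j x.

(* The ultrafilter replaces the extraction of a subsequence in Helly's theorem. *)
Definition limit_cdf (t : R) : R := lim (weight_cdf S m t @[m --> U]).

Lemma limit_cdf_cvg t : weight_cdf S m t @[m --> U] --> limit_cdf t.
Proof.
apply: (ultra_bounded_cvg U _ (expR t * (S 0%N 1 + 1)) UU).
have : \forall m \near U, S 0%N (shifted m (1 : R)) <= S 0%N 1 + 1.
  apply: UN; have /cvgrPdist_le/(_ 1 ltr01) := S0_shifted_cvg S dS 1 ltr01.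
  by apply: filterS => m; rewrite ler_norml => /andP[]; lra.
apply: filterS => m Sm; rewrite weight_cdf_ge0//=.
by rewrite (le_trans (weight_cdf_le S dS S_ge0 m t))// ler_wpM2l// expR_ge0.
Qed.

Lemma limit_cdf_ge0 t : 0 <= limit_cdf t.
Proof.
apply: (cvgr_to_ge (limit_cdf_cvg t)).
by apply: nearW => m; exact: weight_cdf_ge0.
Qed.

Lemma limit_cdf_nd s t : s <= t -> limit_cdf s <= limit_cdf t.
Proof.
move=> st; apply: (ler_cvg_to (limit_cdf_cvg s) (limit_cdf_cvg t)).
by apply: nearW => m; exact: weight_cdf_nd.
Qed.

Lemma limit_cdf_lt0 t : t < 0 -> limit_cdf t = 0.
Proof.
move=> t0; rewrite /limit_cdf; under eq_fun do rewrite weight_cdf_lt0//.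
exact: lim_cst.
Qed.

(** A pointwise limit of distribution functions is nondecreasing but may fail to be right
    continuous, which a Stieltjes measure requires; this is its right-continuous regularization. *)
Definition right_cdf (t : R) : R := inf [set limit_cdf q | q in `]t, +oo[].

Lemma right_cdf_has_inf t : has_inf [set limit_cdf q | q in `]t, +oo[].
Proof.
split; last by exists 0 => _ [q _ <-]; exact: limit_cdf_ge0.
by exists (limit_cdf (t + 1)), (t + 1); rewrite //= in_itv/= ltrDl ltr01.
Qed.

Lemma right_cdf_le s t : s < t -> right_cdf s <= limit_cdf t.
Proof.
move=> st; apply: ge_inf; first by case: (right_cdf_has_inf s).
by exists t; rewrite //= in_itv/= st.
Qed.

Lemma right_cdf_ge t : limit_cdf t <= right_cdf t.
Proof.
apply: lb_le_inf; first by case: (right_cdf_has_inf t).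
move=> r [q]; rewrite /= in_itv/= andbT => tq <-.
exact/limit_cdf_nd/ltW.
Qed.

Lemma right_cdf_nd : nondecreasing right_cdf.
Proof.
move=> s t st; have [->//|nst] := eqVneq s t.
have {nst}st : s < t by rewrite lt_neqAle nst.
exact: le_trans (right_cdf_le _ _ st) (right_cdf_ge t).
Qed.

Lemma right_cdf_lt0 t : t < 0 -> right_cdf t = 0.
Proof.
move=> t0; apply/eqP; rewrite eq_le; apply/andP; split.
  rewrite -(limit_cdf_lt0 (t / 2)); last lra.
  by apply: right_cdf_le; lra.
exact: le_trans (limit_cdf_ge0 _) (right_cdf_ge t).
Qed.

Lemma right_cdf_ge0 t : 0 <= right_cdf t.
Proof. exact: le_trans (limit_cdf_ge0 _) (right_cdf_ge t). Qed.

Lemma right_cdf_rc (s : R) : right_cdf x @[x --> s^'+] --> right_cdf s.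
Proof.
apply/cvgrPdist_le => e e0.
have [_ [q /= + <-] qe] := inf_adherent e0 (right_cdf_has_inf s).
rewrite in_itv/= andbT => sq.
near=> t.
have st : s <= t by exact: ltW.
rewrite distrC ger0_norm ?subr_ge0 ?right_cdf_nd// lerBlDl ltW//.
by apply: le_lt_trans qe; apply: right_cdf_le; near: t; exact: nbhs_right_lt.
Unshelve. all: by end_near. Qed.

HB.instance Definition _ :=
  isCumulative.Build R _ R right_cdf right_cdf_nd right_cdf_rc.


Definition limit_measure : {measure set (measurableTypeR R) -> \bar R} :=
  lebesgue_stieltjes_measure right_cdf.

Lemma limit_measure_itvoc (a b : R) : a <= b ->
  limit_measure `]a, b]%classic = (right_cdf b - right_cdf a)%:E.
Proof.
move=> ab; rewrite /limit_measure/= /lebesgue_stieltjes_measure/=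
  /measure_extension/= measurable_mu_extE/=; last exact: is_ocitv.
by rewrite wlength_itv_bnd.
Qed.

Lemma limit_measure_lt0 : limit_measure `]-oo, 0[%classic = 0%E.
Proof.
apply/negligibleP; first exact: measurable_itv.
pose I (n : nat) : set (measurableTypeR R) := `](- n.+1%:R), (- n.+1%:R^-1)]%classic.
have In n : limit_measure.-negligible (I n).
  apply/negligibleP; first exact: measurable_itv.
  have n1 : - n.+1%:R <= - n.+1%:R^-1 :> R.
    rewrite lerN2 (le_trans (y := 1)) ?ler1n// -[leRHS]invr1.
    by rewrite lef_pV2 ?posrE// ler1n.
  have := limit_measure_itvoc _ _ n1.
  by rewrite !right_cdf_lt0 ?subrr// oppr_lt0 ?invr_gt0.
apply: negligibleS (negligible_bigcup In) => x /=; rewrite in_itv/= => x0.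
have Nx : 0 < - x by lra.
(* Large enough for both - x < n + 1 and 1 / (- x) <= n + 1. *)
pose n := (Num.truncn (- x) + Num.truncn (- x)^-1)%N.
exists n => [//|]; rewrite /I/= in_itv/=; apply/andP; split.
  rewrite ltrNl (lt_le_trans (truncnS_gt _))// ler_nat /n.
  exact: leq_addr.
rewrite lerNr -[leRHS]invrK lef_pV2 ?posrE ?invr_gt0//.
rewrite (le_trans (ltW (truncnS_gt _)))// ler_nat ltnS; exact: leq_addl.
Qed.

(** Starting from ]-1, t], on whose left end the distribution function is 0, keeps the atom at 0
    inside the interval. *)
Lemma limit_measure_itvcc (t : R) : 0 <= t ->
  limit_measure `[0, t]%classic = (right_cdf t)%:E.
Proof.
move=> t0; have t1 : -1 <= t by lra.
have := limit_measure_itvoc _ _ t1; rewrite (right_cdf_lt0 (-1)) ?subr0; last lra.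
move=> <-; have -> : `]-1, t]%classic = `]-1, 0[%classic `|` `[0, t]%classic :> set R.
  apply/seteqP; split=> x /=; rewrite !in_itv/=.
    by move=> /andP[-> ->]; rewrite andbT; case: (ltP x 0); [left|right].
  by move=> [/andP[-> x0]|/andP[x0 ->]]; lra.
rewrite measureU; [|exact: measurable_itv|exact: measurable_itv|]; last first.
  by apply/seteqP; split => x //=; rewrite !in_itv/= => -[/andP[_ x0] /andP[]]; lra.
rewrite [X in (_ = X + _)%E](_ : _ = 0)%E ?add0e//.
apply/eqP; rewrite -measure_le0 -limit_measure_lt0 le_measure ?inE//.
by move=> x /=; rewrite !in_itv/= => /andP[].
Qed.

Variables (psi : R -> R) (T L : R).
Hypothesis T_gt0 : 0 < T.
Hypothesis lip : forall s t : R, 0 <= s -> 0 <= t ->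
  `|psi s - psi t| <= L * `|s - t|.
Hypothesis psi0 : forall s : R, T <= s -> psi s = 0.
Hypothesis mpsi : measurable_fun (`[0, +oo[%classic : set (measurableTypeR R)) psi.

(** Discrete counterpart of [measure_step_approx]; m enters the error only through the mass on
    [0, T], which converges along U. *)
Lemma weight_step_approx p m K : (0 < p)%N -> m.+1%:R * T < K%:R ->
  `|\sum_(k < K) weight S m k * psi (node m k) -
    \sum_(i < p) mesh_drop psi T p i * weight_cdf S m (mesh_point T p i)|
  <= L * (T / p%:R) * weight_cdf S m T.
Proof.
move=> p0 TK; rewrite (weight_cdfE _ _ _ _ TK).
have E (i : 'I_p) : weight_cdf S m (mesh_point T p i) =
    \sum_(k < K) weight S m k * below (mesh_point T p i) (node m k).
  apply: weight_cdfE; apply: le_lt_trans TK; rewrite ler_pM2l//.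
  by rewrite -[leRHS](mesh_point_last T _ p0) mesh_point_le// ltnW.
under [X in `|_ - X|]eq_bigr do rewrite E mulr_sumr.
rewrite exchange_big/= -sumrB mulr_sumr (le_trans (ler_norm_sum _ _ _))//.
apply: ler_sum => k _.
under eq_bigr do rewrite mulrCA.
rewrite -mulr_sumr -mulrBr normrM ger0_norm ?weight_ge0// [leRHS]mulrCA.
apply: ler_wpM2l; first exact: weight_ge0.
exact: step_approx (node_ge0 _ _).
Qed.

(* [limit_cdf] and [right_cdf] may differ at the jumps, but on a mesh they interlace:
   [limit_cdf s <= right_cdf s <= limit_cdf t] for [s < t]. *)
Lemma limit_right_cdf_approx p : (0 < p)%N ->
  `|\sum_(i < p) mesh_drop psi T p i * limit_cdf (mesh_point T p i) -
    \sum_(i < p) mesh_drop psi T p i * right_cdf (mesh_point T p i)|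
  <= L * (T / p%:R) * right_cdf T.
Proof.
move=> p0; have d0 : 0 < T / p%:R by rewrite divr_gt0// ltr0n.
have Ld0 : 0 <= L * (T / p%:R).
  exact: le_trans (mesh_drop_le psi T L p T_gt0 lip 0).
rewrite -sumrB (le_trans (ler_norm_sum _ _ _))//.
apply: (@le_trans _ _ (\sum_(i < p) L * (T / p%:R) *
    (limit_cdf (mesh_point T p i.+1) - limit_cdf (mesh_point T p i)))).
  apply: ler_sum => i _; rewrite -mulrBr normrM; apply: ler_pM => //.
    exact: mesh_drop_le.
  rewrite ler0_norm ?subr_le0 ?right_cdf_ge// opprB lerB//.
  by apply: right_cdf_le; rewrite mesh_pointS ltrDl.
rewrite -mulr_sumr; apply: ler_wpM2l => //.
rewrite -(big_mkord xpredT (fun i =>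
  limit_cdf (mesh_point T p i.+1) - limit_cdf (mesh_point T p i))).
rewrite telescope_sumr// mesh_point_last// lerBlDr.
by rewrite (le_trans (right_cdf_ge T))// lerDl limit_cdf_ge0.
Qed.

(** Weak convergence for Lipschitz functions of bounded support. For a fixed mesh, four quantities
    are compared in turn: the discrete sum A, its mesh sum [B m], the mesh sum C of [limit_cdf], the
    mesh sum D of [right_cdf], and finally the integral E. *)
Lemma weight_sum_cvg (K : nat -> nat) : (forall m, m.+1%:R * T < (K m)%:R) ->
  \sum_(k < K m) weight S m k * psi (node m k) @[m --> U] -->
  \int[limit_measure]_(s in `[0, +oo[) psi s.
Proof.
move=> TK; apply/cvgrPdist_le => e e0.
have L0 : 0 <= L.
  have := lip 0 1 (lexx _) ler01; rewrite sub0r normrN1 mulr1.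
  exact: le_trans.
pose M := right_cdf T; have M0 : 0 <= M := right_cdf_ge0 T.
(* The three mesh errors are L T / p times M for E - D, M for C - D and M + 1 for A - B, hence the
   factor 3 M + 1; the other half of e is left for C - B. *)
pose p := (Num.truncn (2 * (L * T * (3 * M + 1)) / e)).+1.
have pE : L * (T / p%:R) * (3 * M + 1) <= e / 2.
  have : 2 * (L * T * (3 * M + 1)) / e <= p%:R by exact: ltW (truncnS_gt _).
  rewrite ler_pdivrMr// => h.
  rewrite mulrA mulrAC ler_pdivrMr ?ltr0n//; lra.
have p0 : (0 < p)%N by [].
pose B m := \sum_(i < p) mesh_drop psi T p i * weight_cdf S m (mesh_point T p i).
pose C := \sum_(i < p) mesh_drop psi T p i * limit_cdf (mesh_point T p i).
have BC : B m @[m --> U] --> C.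
  have cdfc (i : 'I_p) : mesh_drop psi T p i * weight_cdf S m (mesh_point T p i)
      @[m --> U] --> mesh_drop psi T p i * limit_cdf (mesh_point T p i).
    by apply: cvgM; [exact: cvg_cst|exact: limit_cdf_cvg].
  have add_c : continuous (fun x : R * R => x.1 + x.2) by exact: add_continuous.
  exact: (cvg_big _ _ (fun i _ => cdfc i)).
have e20 : 0 < e / 2 by rewrite divr_gt0.
have T0 := ltW T_gt0.
have muT : (limit_measure `[0%R, T]%classic < +oo)%E.
  by rewrite limit_measure_itvcc// ltry.
have step2 := limit_right_cdf_approx p p0.
have := measure_step_approx psi T L p T_gt0 p0 lip psi0 limit_measure muT mpsi.
rewrite limit_measure_itvcc//=.
have -> : \sum_(i < p) mesh_drop psi T p i *
      fine (limit_measure `[0, mesh_point T p i]%classic) =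
    \sum_(i < p) mesh_drop psi T p i * right_cdf (mesh_point T p i).
  apply: eq_bigr => i _; rewrite limit_measure_itvcc//.
  exact: mesh_point_ge0.
move: step2; rewrite -/C -/M.
set D := \sum_(i < p) _; set E := Rintegral _ _ _ => step2 step3.
have cdfT : \forall m \near U, weight_cdf S m T <= M + 1.
  have /cvgrPdist_le/(_ 1 ltr01) := limit_cdf_cvg T.
  apply: filterS => m; rewrite ler_norml => /andP[].
  by have := right_cdf_ge T; rewrite -/M; lra.
have /cvgrPdist_le/(_ _ e20) := BC.
apply: filterS2 cdfT => m mT; rewrite -/C => step1.
have step0 := weight_step_approx p m (K m) p0 (TK m); rewrite -/(B m) in step0.
set A := \sum_(k < K m) _ in step0 *.
have Ld0 : 0 <= L * (T / p%:R) by rewrite mulr_ge0// divr_ge0.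
have h0 := ler_wpM2l Ld0 mT.
have -> : E - A = (E - D) - (C - D) + (C - B m) - (A - B m) by ring.
rewrite (le_trans (ler_normB _ _))// (le_trans (lerD (ler_normD _ _) (lexx _)))//.
rewrite (le_trans (lerD (lerD (ler_normB _ _) (lexx _)) (lexx _)))//.
move: pE h0 step0 step1 step2 step3.
set q := L * (T / p%:R).
by rewrite -?/M; lra.
Qed.

End StieltjesLimit.

(** * Laplace transform of the limit measure *)

Section TruncatedExponential.
Context {R : realType}.
Implicit Types x s t T : R.

Lemma expRN_lip x s t : 0 <= x -> 0 <= s -> 0 <= t ->
  `|expR (- (x * s)) - expR (- (x * t))| <= x * `|s - t|.
Proof.
move=> x0; wlog st : s t / s <= t => [hw s0 t0|].
  by have [/hw|/ltW/hw] := leP s t; [|rewrite distrC (distrC s)]; apply.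
move=> s0 t0; have xs0 : - (x * s) <= 0 by rewrite oppr_le0 mulr_ge0.
have xst : x * s <= x * t by rewrite ler_wpM2l.
rewrite distrC ler0_norm; last by rewrite subr_le0 ler_expR lerN2.
rewrite opprB distrC ger0_norm ?subr_ge0//.
have -> : - (x * t) = - (x * s) + - (x * (t - s)) by ring.
rewrite expRD -[X in X - _]mulr1 -mulrBr.
have e1 := expR_ge1Dx (- (x * (t - s))).
have e2 : expR (- (x * s)) <= 1 by rewrite expR_le1.
have e3 : 0 <= x * (t - s) by rewrite mulr_ge0// subr_ge0.
have e4 : 0 <= 1 - expR (- (x * (t - s))) by rewrite subr_ge0 expR_le1; lra.
apply: le_trans (ler_wpM2r e4 e2) _; lra.
Qed.

Lemma expRN_cvg0 x : 0 < x -> expR (- (x * n.+1%:R)) @[n --> \oo] --> (0 : R).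
Proof.
move=> x0; have q1 : `|expR (- x)| < 1.
  by rewrite ger0_norm ?expR_ge0// expR_lt1 oppr_lt0.
rewrite (cvg_shiftS (fun n => expR (- (x * n%:R)))).
under eq_fun do rewrite -mulNr expRM_natr.
exact: cvg_expr.
Qed.

(** Weak convergence is available only for Lipschitz functions vanishing beyond some T. Lowering the
    exponential by its value at T and taking the positive part gives such a function, increasing to
    exp (- x s) as T grows. *)
Definition trunc_exp x T s : R :=
  Order.max (expR (- (x * s)) - expR (- (x * T))) 0.

Lemma trunc_exp_ge0 x T s : 0 <= trunc_exp x T s.
Proof. by rewrite le_max lexx orbT. Qed.

Lemma trunc_exp_eq0 x T s : 0 <= x -> T <= s -> trunc_exp x T s = 0.
Proof.
move=> x0 Ts; apply/max_idPr; rewrite subr_le0 ler_expR lerN2.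
by rewrite ler_wpM2l.
Qed.

Lemma trunc_exp_le x T s : trunc_exp x T s <= expR (- (x * s)).
Proof. by rewrite ge_max expR_ge0 gerBl expR_ge0. Qed.

Lemma trunc_exp_nd x s T T' : 0 <= x -> T <= T' ->
  trunc_exp x T s <= trunc_exp x T' s.
Proof.
move=> x0 TT'; rewrite ge_max trunc_exp_ge0 andbT le_max lerB//.
by rewrite ler_expR lerN2 ler_wpM2l.
Qed.

(** Tightness: half of the exponent pays for the small factor exp (- x T / 2), and the other half
    leaves the kernel at x / 2, whose sums are bounded. Thus no mass is lost at infinity. *)
Lemma trunc_exp_tail x T s : 0 <= x -> 0 <= T ->
  expR (- (x * s)) <= trunc_exp x T s + expR (- (x / 2 * T)) * expR (- (x / 2 * s)).
Proof.
move=> x0 T0; have [sT|Ts] := leP s T.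
  rewrite (@le_trans _ _ (expR (- (x * s)) - expR (- (x * T)) + expR (- (x * T))))//.
    by rewrite subrK.
  apply: lerD; first by rewrite le_max lexx.
  rewrite -expRD ler_expR.
  have : x / 2 * s <= x / 2 * T by rewrite ler_wpM2l// divr_ge0.
  lra.
rewrite trunc_exp_eq0 ?(ltW Ts)// add0r -expRD ler_expR.
have : x / 2 * T <= x / 2 * s by rewrite ler_wpM2l ?divr_ge0// ltW.
lra.
Qed.

Lemma trunc_exp_lip x T s t : 0 <= x -> 0 <= s -> 0 <= t ->
  `|trunc_exp x T s - trunc_exp x T t| <= x * `|s - t|.
Proof.
move=> x0 s0 t0; apply: le_trans (expRN_lip x s t x0 s0 t0); rewrite /trunc_exp.
set a := expR (- (x * s)); set b := expR (- (x * t)); set c := expR (- (x * T)).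
have -> : a - b = (a - c) - (b - c) by ring.
move: (a - c) (b - c) => {a b c} a b.
have h1 := ler_norm (a - b); have := ler_norm (b - a); rewrite distrC => h2.
rewrite ler_norml /Order.max; case: ifP => a0; case: ifP => b0; lra.
Qed.

Lemma measurable_expRN x (D : set (measurableTypeR R)) :
  measurable_fun D (fun s : measurableTypeR R => expR (- (x * s))).
Proof.
apply: measurable_funTS; apply: measurableT_comp => //.
by apply: measurableT_comp => //; apply: measurable_funM.
Qed.

Lemma measurable_trunc_exp x T (D : set (measurableTypeR R)) :
  measurable_fun D (trunc_exp x T : measurableTypeR R -> R).
Proof.
apply: measurable_maxr => //; apply: measurable_funB => //.
exact: measurable_expRN.
Qed.

End TruncatedExponential.

Section LimitLaplace.
Context {R : realType}.
Variable U : set_system nat.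
Hypothesis UU : UltraFilter U.
Hypothesis UN : \oo `<=` U.
Variable S : nat -> R -> R.
Hypothesis dS : forall j (x : R), 0 < x -> is_derive x 1 (S j) (- S j.+1 x).
Hypothesis S_ge0 : forall j (x : R), 0 < x -> 0 <= S j x.

Let alpha := limit_measure U UU UN S dS S_ge0.

(** Both bounds hold for the discrete measures, whose full series at x is [S 0] at [shifted m x],
    and pass to the limit along U. *)
Lemma limit_trunc_exp (x T : R) : 0 < x -> 0 < T ->
  \int[alpha]_(s in `[0, +oo[) trunc_exp x T s <= S 0%N x <=
  \int[alpha]_(s in `[0, +oo[) trunc_exp x T s +
    expR (- (x / 2 * T)) * S 0%N (x / 2).
Proof.
move=> x0 T0; set I := Rintegral _ _ _; have x20 : 0 < x / 2 by rewrite divr_gt0.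
pose K m := (Num.truncn (m.+1%:R * T)).+1.
have TK m : m.+1%:R * T < (K m)%:R by exact: truncnS_gt.
pose A m := \sum_(k < K m) weight S m k * trunc_exp x T (node m k).
have AI : A m @[m --> U] --> I.
  apply: (weight_sum_cvg U UU UN S dS S_ge0 _ T x) => //.
  - by move=> s t; apply: trunc_exp_lip; exact: ltW.
  - by move=> s; apply: trunc_exp_eq0; exact: ltW.
  - exact: measurable_trunc_exp.
have SU y : 0 < y -> S 0%N (shifted m y) @[m --> U] --> S 0%N y.
  by move=> y0 B /(S0_shifted_cvg S dS _ y0)/UN.
apply/andP; split.
  apply: (ler_cvg_to AI (SU _ x0)); apply: nearW => m.
  apply: le_trans (weight_series_le S dS S_ge0 m x (K m) x0).
  apply: ler_sum => k _; apply: ler_wpM2l; first exact: weight_ge0.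
  exact: trunc_exp_le.
have BI : A m + expR (- (x / 2 * T)) * S 0%N (shifted m (x / 2)) @[m --> U] -->
    I + expR (- (x / 2 * T)) * S 0%N (x / 2).
  by apply: cvgD => //; apply: cvgM; [exact: cvg_cst|exact: SU].
apply: (ler_cvg_to (SU _ x0) BI); apply: nearW => m.
apply: (cvgr_to_le (weight_series_cvg S dS S_ge0 m x x0)).
exists (K m) => // n /= Kn.
have E : \sum_(k < n) weight S m k * trunc_exp x T (node m k) = A m.
  pose F k := weight S m k * trunc_exp x T (node m k).
  rewrite /A -!(big_mkord xpredT F) (big_cat_nat (leq0n _) Kn)/=.
  rewrite [X in _ + X]big_nat_cond [X in _ + X]big1 ?addr0//.
  move=> k /andP[/andP[Kk _] _]; rewrite /F trunc_exp_eq0 ?mulr0 ?(ltW x0)//.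
  rewrite ler_pdivlMr// mulrC (le_trans (ltW (TK m)))// ler_nat; exact: Kk.
rewrite -E.
apply: le_trans (lerD (lexx _) (ler_wpM2l (expR_ge0 _)
  (weight_series_le S dS S_ge0 m (x / 2) n x20))).
rewrite mulr_sumr -big_split/=; apply: ler_sum => k _.
rewrite [X in _ <= _ + X]mulrCA -mulrDr; apply: ler_wpM2l; first exact: weight_ge0.
by apply: trunc_exp_tail; exact: ltW.
Qed.

Lemma limit_laplace (x : R) : 0 < x ->
  (\int[alpha]_(s in `[0%R, +oo[) (expR (- (x * s)))%:E = (S 0%N x)%:E)%E.
Proof.
move=> x0; pose g n (s : R) := (trunc_exp x n.+1%:R s)%:E.
have mD : measurable (`[0, +oo[%classic : set (measurableTypeR R)) by [].
have mg n : measurable_fun (`[0, +oo[%classic : set (measurableTypeR R))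
    (g n : measurableTypeR R -> \bar R).
  exact: (measurable_EFinR (measurable_trunc_exp _ _ _)).
have g0 n s : `[0, +oo[%classic s -> (0 <= g n s)%E.
  by move=> _; rewrite lee_fin trunc_exp_ge0.
have gnd s : `[0, +oo[%classic s -> {homo g ^~ s : n m / (n <= m)%N >-> (n <= m)%E}.
  by move=> _ n m nm; rewrite lee_fin trunc_exp_nd ?(ltW x0)// ler_nat ltnS.
have gI n : (\int[alpha]_(s in `[0%R, +oo[) g n s)%E =
    (\int[alpha]_(s in `[0, +oo[) trunc_exp x n.+1%:R s)%:E.
  rewrite /Rintegral fineK//; apply: integrable_fin_num => //.
  apply: (integrable_bounded_support alpha n.+1%:R _ _ 1).
  - by rewrite limit_measure_itvcc// ltry.
  - exact: measurable_trunc_exp.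
  - move=> s s0; rewrite mul1r ger0_norm ?trunc_exp_ge0//.
    have [sn|ns] := leP s n.+1%:R.
      rewrite below1// (le_trans (trunc_exp_le _ _ _))// expR_le1 oppr_le0.
      by rewrite mulr_ge0// ltW.
    by rewrite trunc_exp_eq0 ?below_ge0// ltW.
have cvgI : (\int[alpha]_(s in `[0%R, +oo[) g n s)%E @[n --> \oo] --> (S 0%N x)%:E.
  under eq_fun do rewrite gI.
  apply: cvg_EFin; first exact: nearW.
  have lo : S 0%N x - expR (- (x / 2 * n.+1%:R)) * S 0%N (x / 2) @[n --> \oo] --> S 0%N x.
    have := cvgB (@cvg_cst _ (S 0%N x) _ \oo _)
      (cvgM (expRN_cvg0 (x / 2) (divr_gt0 x0 (ltr0Sn _ 1)))
        (@cvg_cst _ (S 0%N (x / 2)) _ \oo _)).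
    by rewrite mul0r subr0; apply.
  apply: (squeeze_cvgr _ lo (@cvg_cst _ (S 0%N x) _ \oo _)).
  apply: nearW => n /=; have /andP[-> h] := limit_trunc_exp x n.+1%:R x0 (ltr0Sn _ _).
  by rewrite andbT; lra.
have := @cvg_monotone_convergence _ _ _ alpha _ mD g mg g0 gnd.
have -> : (\int[alpha]_(s in `[0%R, +oo[) limn (g^~ s))%E =
    (\int[alpha]_(s in `[0%R, +oo[) (expR (- (x * s)))%:E)%E.
  apply: eq_integral => s /[!inE] /=; rewrite in_itv/= andbT => s0.
  apply/cvg_lim => //; rewrite /g; apply: cvg_EFin; first exact: nearW.
  have lo : expR (- (x * s)) - expR (- (x * n.+1%:R)) @[n --> \oo] --> expR (- (x * s)).
    have := cvgB (@cvg_cst _ (expR (- (x * s))) _ \oo _) (expRN_cvg0 x x0).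
    by rewrite subr0; apply.
  apply: (squeeze_cvgr _ lo (@cvg_cst _ (expR (- (x * s))) _ \oo _)).
  by apply: nearW => n /=; rewrite trunc_exp_le andbT le_max lexx.
by move=> h; exact: (cvg_unique _ h cvgI).
Qed.

End LimitLaplace.

Lemma bounded_derive_lip {R : realType} (f f' : R -> R) (L : R) :
  (forall x : R, is_derive x 1 f (f' x)) -> (forall x : R, `|f' x| <= L) ->
  forall s t : R, `|f s - f t| <= L * `|s - t|.
Proof.
move=> df f'L s t; wlog st : s t / s <= t => [hw|].
  by have [/hw|/ltW/hw] := leP s t; [|rewrite distrC (distrC s)]; apply.
have cf : {within `[s, t], continuous f}.
  by apply: derivable_within_continuous => x _; case: (df x).
have [c _ e] := MVT_segment st (fun x _ => df x) cf.
by rewrite distrC e normrM (distrC s); apply: ler_wpM2r.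
Qed.

(** * The Euler operator and its dual *)

Section EulerDual.
Context {R : realType}.
Variable U : set_system nat.
Hypothesis UU : UltraFilter U.
Hypothesis UN : \oo `<=` U.
Variables (S S' : nat -> R -> R) (a : R).
Hypothesis dS : forall j (x : R), 0 < x -> is_derive x 1 (S j) (- S j.+1 x).
Hypothesis S_ge0 : forall j (x : R), 0 < x -> 0 <= S j x.
Hypothesis dS' : forall j (x : R), 0 < x -> is_derive x 1 (S' j) (- S' j.+1 x).
Hypothesis S'_ge0 : forall j (x : R), 0 < x -> 0 <= S' j x.
Hypothesis euler0 : forall x : R, 0 < x -> S' 0%N x = a * S 0%N x - x * S 1%N x.

Lemma euler_all n (x : R) : 0 < x -> S' n x = (n%:R + a) * S n x - x * S n.+1 x.
Proof.
elim: n x => [|n IHn] x x0; first by rewrite add0r euler0.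
have d1 := isder_sub (isder_scale (n%:R + a) (dS n x x0))
  (isder_mul (isder_id x) (dS n.+1 x x0)).
have oI : open (`]0, +oo[%classic : set R) by exact: interval_open.
have E : {in `]0, +oo[%classic, (fun z => (n%:R + a) * S n z - z * S n.+1 z) =1 S' n}.
  by move=> z; rewrite inE/= in_itv/= andbT => /IHn ->.
have xI : `]0, +oo[%classic x by rewrite /= in_itv/= x0.
have [_ e1] := is_derive_eq_on _ oI E xI d1; have [_ e2] := dS' n x x0.
move: e1; rewrite e2 => e; apply: oppr_inj; rewrite e -natr1; ring.
Qed.

Lemma weight_euler m k :
  weight S' m k = (k%:R + a) * weight S m k - k.+1%:R * weight S m k.+1.
Proof.
rewrite /weight euler_all ?ltr0Sn// factS natrM exprS; field.
by rewrite !pnatr_eq0 -lt0n fact_gt0 addrC natr1 pnatr_eq0.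
Qed.

Variables (psi psi' eta' : R -> R) (T L M : R).
Let eta s := s * psi' s.
Hypothesis T_gt0 : 0 < T.
Hypothesis dpsi : forall s : R, is_derive s 1 psi (psi' s).
Hypothesis deta : forall s : R, is_derive s 1 eta (eta' s).
Hypothesis psi'_le : forall s : R, `|psi' s| <= L.
Hypothesis eta'_le : forall s : R, `|eta' s| <= M.
Hypothesis psi0 : forall s : R, T <= s -> psi s = 0.
Hypothesis psi'0 : forall s : R, T <= s -> psi' s = 0.

(* Summation by parts; for [k = 0] the junk value [k.-1 = 0] is multiplied by 0. *)
Lemma euler_sum m K : m.+1%:R * T < K%:R ->
  \sum_(k < K.+1) weight S' m k * psi (node m k) =
  \sum_(k < K.+1) weight S m k *
    (a * psi (node m k) + k%:R * (psi (node m k) - psi (node m k.-1))).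
Proof.
move=> TK; have nodeK : T <= node m K by rewrite ler_pdivlMr// mulrC ltW.
transitivity (\sum_(k < K.+1) (k%:R + a) * weight S m k * psi (node m k) -
    \sum_(k < K.+2) k%:R * weight S m k * psi (node m k.-1)).
  rewrite [X in _ - X]big_ord_recl/= !mul0r add0r -sumrB; apply: eq_bigr => k _.
  by rewrite weight_euler /bump/= add1n; ring.
rewrite [X in _ - X]big_ord_recr/= [psi (node m K)]psi0// mulr0 addr0 -sumrB.
by apply: eq_bigr => k _; ring.
Qed.

(** By the mean value theorem, k times the backward difference of psi is the node times psi' at an
    intermediate point, hence close to s psi'(s). The bound reaches to T + 1 because the previous
    node, at distance at most 1, may still lie below T. *)
Lemma euler_local m k :
  `|k%:R * (psi (node m k) - psi (node m k.-1)) - eta (node m k)|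
  <= (L + M) * m.+1%:R^-1 * below (T + 1) (node m k).
Proof.
have L0 : 0 <= L by exact: le_trans (psi'_le 0).
have M0 : 0 <= M by exact: le_trans (eta'_le 0).
case: k => [|k].
  rewrite /eta /node !mul0r subrr normr0 mulr_ge0 ?below_ge0//.
  by rewrite mulr_ge0// addr_ge0.
rewrite [k.+1.-1]/=.
have kS : node m k.+1 - node m k = m.+1%:R^-1 :> R.
  by rewrite /node -natr1; field; rewrite nat1r pnatr_eq0.
have m0 : 0 < m.+1%:R^-1 :> R by rewrite invr_gt0.
have m1 : m.+1%:R^-1 <= 1 :> R by rewrite invf_le1// ler1n.
move: kS m0 m1; move dE: (m.+1%:R^-1 : R) => d kS d0 d1.
have [kT|Tk] := leP (node m k.+1 : R) (T + 1); last first.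
  have T1 : T <= node m k.+1 :> R by lra.
  have T0 : T <= node m k :> R by lra.
  by rewrite (below0 _ _ Tk) mulr0 normr_le0 /eta !psi0// psi'0// !mulr0 !subr0 mulr0.
rewrite below1// mulr1.
have cpsi : {within `[node m k, node m k.+1], continuous psi}.
  by apply: derivable_within_continuous => x _; case: (dpsi x).
have kk : node m k <= node m k.+1 :> R by lra.
have [c + e] := MVT_segment kk (fun x _ => dpsi x) cpsi.
rewrite in_itv/= => /andP[kc ck].
rewrite e kS.
have -> : k.+1%:R * (psi' c * d) = node m k.+1 * psi' c.
  by rewrite /node -dE; ring.
have -> : node m k.+1 * psi' c - eta (node m k.+1) =
    (node m k.+1 - c) * psi' c + (eta c - eta (node m k.+1)).
  by rewrite /eta; ring.
rewrite (le_trans (ler_normD _ _))// [(L + M) * d]mulrDl; apply: lerD.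
  rewrite normrM mulrC; apply: ler_pM => //.
  by rewrite ger0_norm; lra.
apply: le_trans (bounded_derive_lip eta eta' M deta eta'_le _ _) _.
by apply: ler_wpM2l => //; rewrite ler0_norm; lra.
Qed.

Lemma euler_dual :
  \int[limit_measure U UU UN S' dS' S'_ge0]_(s in `[0, +oo[) psi s =
  \int[limit_measure U UU UN S dS S_ge0]_(s in `[0, +oo[) (a * psi s + eta s).
Proof.
(* One more than needed to pass T + 1: [euler_sum] is stated for a range K + 1 with node K already
   beyond T. *)
pose K m := (Num.truncn (m.+1%:R * (T + 1))).+2.
have TK m : m.+1%:R * (T + 1) < (K m).-1%:R by exact: truncnS_gt.
have TK' m : m.+1%:R * T < (K m).-1%:R.
  by apply: le_lt_trans (TK m); rewrite ler_pM2l//; lra.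
have TK1 m : m.+1%:R * T < (K m)%:R.
  by apply: lt_le_trans (TK' m) _; rewrite ler_nat.
have cts (f f' : R -> R) : (forall s : R, is_derive s 1 f (f' s)) ->
    measurable_fun (`[0, +oo[%classic : set (measurableTypeR R))
      (f : measurableTypeR R -> R).
  move=> df; apply: measurable_funTS; apply: continuous_measurable_fun => s.
  by apply/differentiable_continuous/derivable1_diffP; case: (df s).
have c1 : \sum_(k < K m) weight S' m k * psi (node m k) @[m --> U] -->
    \int[limit_measure U UU UN S' dS' S'_ge0]_(s in `[0, +oo[) psi s.
  apply: (weight_sum_cvg U UU UN S' dS' S'_ge0 _ T L) => //.
    by move=> s t _ _; exact: bounded_derive_lip dpsi psi'_le s t.
  exact: cts dpsi.
pose g s := a * psi s + eta s.
have dg (s : R) : is_derive s 1 g (a * psi' s + eta' s).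
  exact: isder_add (isder_scale a (dpsi s)) (deta s).
have c2 : \sum_(k < K m) weight S m k * g (node m k) @[m --> U] -->
    \int[limit_measure U UU UN S dS S_ge0]_(s in `[0, +oo[) g s.
  apply: (weight_sum_cvg U UU UN S dS S_ge0 _ T (`|a| * L + M)) => //.
  - move=> s t _ _; apply: (bounded_derive_lip _ _ _ dg) => x.
    rewrite (le_trans (ler_normD _ _))// lerD// normrM; exact: ler_wpM2l.
  - by move=> s Ts; rewrite /g /eta psi0// psi'0// !mulr0 addr0.
  - exact: cts dg.
pose E m := \sum_(k < K m) weight S m k *
  (k%:R * (psi (node m k) - psi (node m k.-1)) - eta (node m k)).
have EE m : \sum_(k < K m) weight S' m k * psi (node m k) =
    \sum_(k < K m) weight S m k * g (node m k) + E m.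
  rewrite -[K m]prednK// euler_sum// -big_split/=; apply: eq_bigr => k _.
  by rewrite /g; ring.
have E_le m : `|E m| <= (L + M) * (m.+1%:R^-1 * weight_cdf S m (T + 1)).
  rewrite (weight_cdfE _ _ _ (K m)); last first.
    by apply: lt_le_trans (TK m) _; rewrite ler_nat.
  rewrite mulrA mulr_sumr (le_trans (ler_norm_sum _ _ _))//; apply: ler_sum => k _.
  rewrite normrM ger0_norm ?weight_ge0// [leRHS]mulrCA.
  by apply: ler_wpM2l; [exact: weight_ge0|exact: euler_local].
have E0 : E m @[m --> U] --> 0.
  apply: norm_cvg0.
  have b0 : (L + M) * (m.+1%:R^-1 * weight_cdf S m (T + 1)) @[m --> U] --> 0.
    have h0 : m.+1%:R^-1 @[m --> U] --> (0 : R).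
      by move=> B /(@cvg_harmonic R) /UN.
    have := cvgM (@cvg_cst _ (L + M) _ U _)
      (cvgM h0 (limit_cdf_cvg U UU UN S dS S_ge0 (T + 1))).
    by rewrite mul0r mulr0; apply.
  apply: (squeeze_cvgr _ (@cvg_cst _ (0 : R) _ U _) b0).
  by apply: nearW => m; rewrite normr_ge0 E_le.
have c3 : \sum_(k < K m) weight S' m k * psi (node m k) @[m --> U] -->
    \int[limit_measure U UU UN S dS S_ge0]_(s in `[0, +oo[) g s.
  under eq_fun do rewrite EE.
  by have := cvgD c2 E0; rewrite addr0; apply.
exact: cvg_unique c1 c3.
Qed.

End EulerDual.

(** * Measures with a density *)

Section DensityMeasure.
Import HBNNSimple.
Context {d} {T : measurableType d} {R : realType}.
Variables (mu : {measure set T -> \bar R}) (g : T -> R).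
Hypothesis mg : measurable_fun setT g.
Hypothesis g_ge0 : forall x, 0 <= g x.

Local Open Scope ereal_scope.

Definition density_fun (A : set T) : \bar R := \int[mu]_(x in A) (g x)%:E.

Let mEg : measurable_fun setT (EFin \o g).
Proof. exact/measurable_EFinP. Qed.

Let density0 : density_fun set0 = 0.
Proof. exact: integral_set0. Qed.

Let density_ge0 A : 0 <= density_fun A.
Proof. by apply: integral_ge0 => x _; rewrite lee_fin. Qed.

Let density_sigma_additive : semi_sigma_additive density_fun.
Proof.
move=> /= A mA tA mUA; rewrite /density_fun ge0_integral_bigcup//; last 2 first.
- exact: measurable_funTS.
- by move=> x _; rewrite lee_fin.
by apply: is_cvg_ereal_nneg_natsum_cond => n _ _; exact: density_ge0.
Qed.

HB.instance Definition _ := isMeasure.Build _ _ _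
  density_fun density0 density_ge0 density_sigma_additive.

Definition density : {measure set T -> \bar R} := density_fun.

Lemma integral_density_nnsfun (h : {nnsfun T >-> R}) :
  \int[density]_x (h x)%:E = \int[mu]_x ((h x)%:E * (g x)%:E).
Proof.
have mhg y : measurable_fun setT (fun x => (\1_(h @^-1` [set y]) x)%:E * (g x)%:E).
  apply: emeasurable_funM => //; apply/measurable_EFinP; exact: measurable_indic.
rewrite integralT_nnsfun sintegralE.
transitivity (\int[mu]_x \sum_(y \in range h)
    (y%:E * ((\1_(h @^-1` [set y]) x)%:E * (g x)%:E))); last first.
  apply: eq_integral => x _; rewrite [in RHS]fimfunE -fsumEFin//.
  rewrite ge0_mule_fsuml => [|y]; last exact: nnfun_muleindic_ge0.
  by apply: eq_fsbigr => y _; rewrite EFinM muleA.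
rewrite ge0_integral_fsum//; last 2 first.
- by move=> y; apply: measurable_funeM.
- by move=> y x _; rewrite muleA mule_ge0 ?lee_fin//; exact: nnfun_muleindic_ge0.
apply: eq_fsbigr => y /[!inE] -[t _ <-].
rewrite ge0_integralZl//; [|by move=> x _; rewrite mule_ge0 ?lee_fin|by rewrite lee_fin].
congr (_ * _); rewrite /density/= /density_fun integral_mkcond.
apply: eq_integral => x _; rewrite patchE indicE.
by case: ifPn; rewrite ?mul1e ?mul0e.
Qed.

Lemma ge0_integral_densityT (f : T -> \bar R) : measurable_fun setT f ->
  (forall x, 0 <= f x) ->
  \int[density]_x f x = \int[mu]_x (f x * (g x)%:E).
Proof.
move=> mf f0; pose h := nnsfun_approx measurableT mf.
have hf x : (h n x)%:E @[n --> \oo] --> f x.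
  by apply: (@cvg_nnsfun_approx _ _ _ _ measurableT _ mf) => // y _.
have hnd x : {homo (fun n => (h n x)%:E) : a b / (a <= b)%N >-> a <= b}.
  by move=> a b ab; rewrite lee_fin; exact/lefP/nd_nnsfun_approx.
transitivity (limn (fun n => \int[density]_x (h n x)%:E)).
  rewrite -monotone_convergence//.
  - by apply: eq_integral => x _; apply/esym/cvg_lim => //; exact: hf.
  - by move=> n; exact/measurable_EFinP.
  - by move=> n x _; rewrite lee_fin.
under eq_fun do rewrite integral_density_nnsfun.
rewrite -monotone_convergence//.
- apply: eq_integral => x _; apply/cvg_lim => //.
  by apply: cvgeZr => //; exact: hf.
- by move=> n; apply: emeasurable_funM => //; exact/measurable_EFinP.
- by move=> n x _; rewrite mule_ge0 ?lee_fin.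
- by move=> x _ a b ab; rewrite lee_wpmul2r ?lee_fin//; exact/lefP/nd_nnsfun_approx.
Qed.

Lemma ge0_integral_density (D : set T) (f : T -> \bar R) : measurable D ->
  measurable_fun D f -> (forall x, D x -> 0 <= f x) ->
  \int[density]_(x in D) f x = \int[mu]_(x in D) (f x * (g x)%:E).
Proof.
move=> mD mf f0; rewrite integral_mkcond ge0_integral_densityT; last 2 first.
- exact: (measurable_restrictT f mD).1 mf.
- by move=> x; rewrite patchE; case: ifPn => //; rewrite inE => /f0.
rewrite [RHS]integral_mkcond; apply: eq_integral => x _; rewrite !patchE.
by case: ifPn => //; rewrite mul0e.
Qed.

(** The positive and negative parts are handled separately, so that the identity covers the
    non-integrable case too, where both sides take the same default value. *)
Lemma Rintegral_density (D : set T) (f : T -> R) : measurable D ->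
  measurable_fun D f ->
  (\int[density]_(x in D) f x = \int[mu]_(x in D) (f x * g x))%R.
Proof.
move=> mD mf; rewrite /Rintegral; congr fine.
have mEf : measurable_fun D (EFin \o f) by exact/measurable_EFinP.
rewrite integralE [RHS]integralE; congr (_ - _).
- rewrite ge0_integral_density//; last exact: measurable_funepos.
  by apply: eq_integral => x _; rewrite !funeposE/= EFinM maxe_pMl ?lee_fin// mul0e.
- rewrite ge0_integral_density//; last exact: measurable_funeneg.
  by apply: eq_integral => x _; rewrite !funenegE/= -mulNr EFinM maxe_pMl ?lee_fin// mul0e.
Qed.

End DensityMeasure.

(** * Test functions *)

Section TestFunctions.
Context {R : realType}.
Implicit Types (phi h : R -> R).

Lemma open_gt0 : open (`]0, +oo[%classic : set R).
Proof. exact: interval_open. Qed.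

Lemma in_gt0 (x : R) : 0 < x -> `]0, +oo[%classic x.
Proof. by move=> x0; rewrite /= in_itv/= x0. Qed.

(** Working form of the definition. The lower bound e exists because the complement of the closed
    support is a neighbourhood of 0. *)
Lemma test_functionP phi : test_function phi <->
  smooth_on setT phi /\
  exists e T : R, 0 < e /\ forall s, phi s != 0 -> e <= s <= T.
Proof.
rewrite /test_function; set supp := closure _; split.
  case=> sphi csupp supp0; split=> //.
  have [T [_ HT]] := compact_bounded csupp.
  have HT' : forall x, supp x -> `|x| <= `|T| + 1.
    apply: HT; rewrite (le_lt_trans (ler_norm _))// ltrDl//.
  have o0 : open_nbhs (0 : R) (~` supp).
    split; first by apply: closed_openC; exact: closed_closure.
    by move=> /supp0; rewrite /= in_itv/= ltxx.
  have /nbhs_ballP[e /= e0 eb] := open_nbhs_nbhs o0.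
  exists e, (`|T| + 1); split=> // s phis.
  have ss : supp s by exact: subset_closure.
  have := supp0 _ ss; rewrite /= in_itv/= andbT => s0.
  rewrite (le_trans (ler_norm _) (HT' _ ss)) andbT leNgt; apply/negP => se.
  apply: (eb s) => //; rewrite /ball/= sub0r normrN ger0_norm//; exact: ltW.
move=> [sphi [e [T [e0 HT]]]].
have sub : supp `<=` `[e, T].
  have /closure_id -> : closed (`[e, T]%classic : set R) by exact: interval_closed.
  by apply: closureS => s /= phis; rewrite in_itv/=; exact: HT.
split=> //.
- by apply: subclosed_compact (@segment_compact _ e T) sub; exact: closed_closure.
- by move=> s /sub; rewrite /= !in_itv/= andbT => /andP[es _]; exact: lt_le_trans es.
Qed.

Lemma test_smooth phi : test_function phi -> smooth_on setT phi.
Proof. by case. Qed.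

Lemma smooth_gt0 phi : test_function phi -> smooth_on `]0, +oo[ phi.
Proof. by move=> /test_smooth; exact: smooth_onS. Qed.

(** The factor h may be singular at 0, as a power of s is. The product is nevertheless smooth on R,
    since it is 0 on ]-oo, e[, which together with ]0, +oo[ covers R. *)
Lemma test_function_mul h phi : smooth_on `]0, +oo[ h -> test_function phi ->
  test_function (fun s => h s * phi s).
Proof.
move=> sh tphi; have [sphi [e [T [e0 HT]]]] := (test_functionP phi).1 tphi.
apply/test_functionP; split; last first.
  exists e, T; split=> // s; rewrite mulf_eq0 negb_or => /andP[_]; exact: HT.
have -> : setT = `]0, +oo[%classic `|` `]-oo, e[%classic :> set R.
  apply/seteqP; split=> // s _; rewrite /= !in_itv/= andbT.
  have [s0|s0] := ltP 0 s; [by left|right; exact: le_lt_trans e0].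
apply: smooth_onU.
  exact: smooth_onM open_gt0 sh (smooth_gt0 _ tphi).
have oI : open (`]-oo, e[%classic : set R) by exact: interval_open.
apply: (smooth_on_eq oI _ (smooth_on_cst _ 0 oI)) => s.
rewrite inE/= in_itv/= => se; rewrite (_ : phi s = 0) ?mulr0//.
by apply/eqP; apply: contraTT se => /HT /andP[es _]; rewrite -leNgt.
Qed.

Lemma test_function_add phi1 phi2 : test_function phi1 -> test_function phi2 ->
  test_function (fun s => phi1 s + phi2 s).
Proof.
move=> /test_functionP[s1 [e1 [T1 [e10 H1]]]] /test_functionP[s2 [e2 [T2 [e20 H2]]]].
apply/test_functionP; split; first exact: smooth_onD openT s1 s2.
exists (Order.min e1 e2), (Order.max T1 T2); split; first by rewrite lt_min e10 e20.
move=> s; rewrite ge_min le_max.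
have [->|/H1/andP[-> ->]//] := eqVneq (phi1 s) 0.
by rewrite add0r => /H2/andP[-> ->]; rewrite !orbT.
Qed.

Lemma test_function_derive1 phi : test_function phi -> test_function (derive1 phi).
Proof.
move=> /test_functionP[sphi [e [T [e0 HT]]]]; apply/test_functionP; split.
  exact: smooth_on_derive1.
exists e, T; split=> // s.
have zero (A : set R) : open A -> A s -> (forall r, A r -> phi r = 0) ->
    derive1 phi s = 0.
  move=> oA As A0; rewrite derive1E.
  have d0 : is_derive s 1 phi 0.
    apply: (is_derive_eq_on 0 oA _ As (isder_cst 0 s)) => r /[!inE] Ar.
    by rewrite A0.
  by case: d0.
have out r : ~~ (e <= r <= T) -> phi r = 0.
  by move=> er; apply/eqP; apply: contraNT er; exact: HT.
apply: contraNT; rewrite negb_and -!ltNge => /orP[se|Ts]; apply/eqP.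
- apply: (zero `]-oo, e[%classic); rewrite /= ?in_itv//=.
  by move=> r; rewrite /= in_itv/= => re; rewrite out// negb_and -ltNge re.
- apply: (zero `]T, +oo[%classic); rewrite /= ?in_itv/= ?Ts//.
  by move=> r; rewrite /= in_itv/= andbT => Tr; rewrite out// negb_and -!ltNge Tr orbT.
Qed.

Lemma test_function_bounded phi : test_function phi ->
  exists L : R, forall s, `|phi s| <= L.
Proof.
move=> /test_functionP[sphi [e [T [e0 HT]]]].
have cphi : continuous phi by move=> s; exact: (smooth_on_continuous sphi).
have cn : {within `[e, Order.max e T], continuous (fun s => `|phi s|)}.
  apply: continuous_subspaceT => s.
  by apply: continuous_comp; [exact: cphi|exact: norm_continuous].
have eT : e <= Order.max e T by rewrite le_max lexx.
have [c _ cmax] := EVT_max eT cn.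
exists `|phi c| => s; have [->|phis] := eqVneq (phi s) 0; first by rewrite normr0.
apply: cmax; rewrite in_itv/= le_max.
by have /andP[-> ->] := HT _ phis; rewrite orbT.
Qed.

Lemma test_function_is_derive phi (s : R) : test_function phi ->
  is_derive s 1 phi (derive1 phi s).
Proof. by move=> /test_smooth sphi; exact: (smooth_on_is_derive sphi I). Qed.

End TestFunctions.

(** * Completely monotonic functions and the representation *)

Section CkRecursion.
Context {R : realType}.
Implicit Types (f g : R -> R) (lambda x : R).

Lemma derive1n_mulX g n x : smooth_on `]0, +oo[ g -> 0 < x ->
  derive1n n (fun y => y * g y) x = x * derive1n n g x + n%:R * derive1n n.-1 g x.
Proof.
move=> sg; pose G n y := y * derive1n n g y + n%:R * derive1n n.-1 g y.
have dG m (y : R) : `]0, +oo[%classic y -> is_derive y 1 (G m) (G m.+1 y).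
  move=> y0; have dg j := is_derive_derive1n j sg y0.
  apply: isder_eq (isder_add (isder_mul (isder_id y) (dg m)) (isder_scale m%:R (dg m.-1))) _.
  rewrite /G; case: m => [|m]; first by rewrite mul0r addr0 !mul1r addrC.
  by rewrite /= -(natr1 m.+1); ring.
have -> : (fun y => y * g y) = G 0%N by apply/funext => y; rewrite /G mul0r addr0.
by move=> x0; rewrite (derive1n_unique _ open_gt0 dG) ?inE//; exact: in_gt0.
Qed.

Lemma smooth_ck_arg lambda k f : smooth_on `]0, +oo[ f ->
  smooth_on `]0, +oo[ (fun y => y `^ (lambda - 1 + k%:R) * f y).
Proof. exact: smooth_onM open_gt0 (smooth_on_powR _). Qed.

Lemma ck0 lambda f x : 0 < x -> ck lambda 0 f x = f x.
Proof.
move=> x0; rewrite /ck/= addr0 mulrA -powRD; last by rewrite (gt_eqF x0) implybT.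
have -> : 1 - lambda + (lambda - 1) = 0 by ring.
by rewrite powRr0 mul1r.
Qed.

(** The recursion for c_{k+1}, solved for the derivative of c_k. If c_k differentiates u, then
    c_{k+1} differentiates y u, and Leibniz's rule gives x u^(k+1) + (k + 1) u^(k). *)
Lemma is_derive_ck lambda k f x : smooth_on `]0, +oo[ f -> 0 < x ->
  is_derive x 1 (ck lambda k f)
    (x^-1 * (ck lambda k.+1 f x - (lambda + k%:R) * ck lambda k f x)).
Proof.
move=> sf x0; set u := fun y => y `^ (lambda - 1 + k%:R) * f y.
have su : smooth_on `]0, +oo[ u by exact: smooth_ck_arg.
have du := is_derive_derive1n k su (in_gt0 _ x0).
apply: isder_eq (isder_mul (is_derive_powR (1 - lambda) x x0) du) _.
rewrite /ck -/u.
have E : {in `]0, +oo[%classic, (fun y => y * u y) =1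
    (fun y => y `^ (lambda - 1 + k.+1%:R) * f y)}.
  move=> y; rewrite inE/= in_itv/= andbT => y0; rewrite /u mulrA; congr (_ * _).
  rewrite -[X in X * _](powRr1 (ltW y0)) -powRD; last by rewrite (gt_eqF y0) implybT.
  by rewrite -natr1; congr (_ `^ _); ring.
rewrite -(derive1n_eq_on k.+1 open_gt0 E); last by rewrite inE; exact: in_gt0.
rewrite (derive1n_mulX _ _ _ su x0) succnK.
have -> : x `^ (1 - lambda - 1) = x^-1 * x `^ (1 - lambda).
  rewrite powRB; last by rewrite (gt_eqF x0) implybT.
  by rewrite powRr1 ?(ltW x0)// mulrC.
rewrite -natr1; field; exact: lt0r_neq0.
Qed.

End CkRecursion.

Section CompletelyMonotonic.
Context {R : realType}.
Variable U : set_system nat.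
Hypothesis UU : UltraFilter U.
Hypothesis UN : \oo `<=` U.
Implicit Types g h : R -> R.

Definition alternating g (j : nat) (x : R) : R := (-1) ^+ j * derive1n j g x.

Lemma is_derive_alternating g : completely_monotonic g ->
  forall j (x : R), 0 < x -> is_derive x 1 (alternating g j) (- alternating g j.+1 x).
Proof.
move=> [sg _] j x x0.
apply: isder_eq (isder_scale _ (is_derive_derive1n j sg (in_gt0 _ x0))) _.
by rewrite /alternating exprS mulN1r mulNr opprK.
Qed.

Lemma alternating_ge0 g : completely_monotonic g ->
  forall j (x : R), 0 < x -> 0 <= alternating g j x.
Proof. by case. Qed.

Definition cm_measure g (cg : completely_monotonic g) :
    {measure set (measurableTypeR R) -> \bar R} :=
  limit_measure U UU UN (alternating g) (is_derive_alternating g cg)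
    (alternating_ge0 g cg).

Lemma cm_measure_laplace g cg (x : R) : 0 < x ->
  (\int[cm_measure g cg]_(s in `[0%R, +oo[) (expR (- (x * s)))%:E = (g x)%:E)%E.
Proof. by move=> x0; rewrite limit_laplace// /alternating expr0 mul1r. Qed.

Lemma cm_measure_itvcc g cg (t : R) : 0 <= t ->
  (cm_measure g cg `[0%R, t]%classic < +oo)%E.
Proof. by move=> t0; rewrite limit_measure_itvcc// ltry. Qed.

Lemma cm_measure_euler g cg h ch (a : R) (psi : R -> R) :
  (forall x, 0 < x -> h x = a * g x + x * derive1 g x) -> test_function psi ->
  \int[cm_measure h ch]_(s in `[0, +oo[) psi s =
  \int[cm_measure g cg]_(s in `[0, +oo[) (a * psi s + s * derive1 psi s).
Proof.
move=> hE tpsi; have tpsi' := test_function_derive1 _ tpsi.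
have teta : test_function (fun s => s * derive1 psi s).
  exact: test_function_mul (smooth_on_id _ open_gt0) tpsi'.
have teta' := test_function_derive1 _ teta.
have [L psiL] := test_function_bounded _ tpsi'.
have [M etaM] := test_function_bounded _ teta'.
have [_ [e [T [e0 HT]]]] := (test_functionP _).1 tpsi.
have [_ [e' [T' [e'0 HT']]]] := (test_functionP _).1 tpsi'.
pose T1 := Order.max 0 (Order.max T T') + 1.
have [T1_0 T1_T T1_T'] : [/\ 0 < T1, T < T1 & T' < T1].
  rewrite /T1; split.
  - by rewrite ltr_pwDr// le_max lexx.
  - by rewrite ltr_pwDr// !le_max lexx orbT.
  - by rewrite ltr_pwDr// !le_max lexx !orbT.
have hE' (x : R) : 0 < x ->
    alternating h 0 x = a * alternating g 0 x - x * alternating g 1 x.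
  by move=> x0; rewrite /alternating /= expr0 expr1 !mul1r (hE _ x0) !mulN1r mulrN opprK.
have psi0 (s : R) : T1 <= s -> psi s = 0.
  move=> Ts; apply/eqP; apply: contraTT (lt_le_trans T1_T Ts) => /HT /andP[_].
  by rewrite -leNgt.
have psi'0 (s : R) : T1 <= s -> derive1 psi s = 0.
  move=> Ts; apply/eqP; apply: contraTT (lt_le_trans T1_T' Ts) => /HT' /andP[_].
  by rewrite -leNgt.
have dpsi (s : R) := test_function_is_derive _ s tpsi.
have deta (s : R) := test_function_is_derive _ s teta.
exact (euler_dual U UU UN (alternating g) (alternating h) a
  (is_derive_alternating g cg) (alternating_ge0 g cg)
  (is_derive_alternating h ch) (alternating_ge0 h ch) hE'
  psi (derive1 psi) _ T1 L M T1_0 dpsi deta psiL etaM psi0 psi'0).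
Qed.

Variable lambda : R.

(** The indicator discards the atom at 0, which the power alone would keep for lambda = 1, because 0
    ^ 0 = 1. *)
Definition power_weight (s : R) : R := s `^ (1 - lambda) * \1_(`]0, +oo[%classic) s.

Lemma power_weight_ge0 s : 0 <= power_weight s.
Proof. by rewrite mulr_ge0 ?powR_ge0. Qed.

Lemma measurable_power_weight :
  measurable_fun [set: measurableTypeR R] (power_weight : measurableTypeR R -> R).
Proof.
apply: measurable_funM; last exact: measurable_indic.
exact: measurable_powR.
Qed.

Definition cm_density g (cg : completely_monotonic g) :
    {measure set (measurableTypeR R) -> \bar R} :=
  density (cm_measure g cg) power_weight measurable_power_weight power_weight_ge0.

Lemma power_weightE (s : R) : 0 < s -> power_weight s = s `^ (1 - lambda).
Proof.
by move=> s0; rewrite /power_weight indicE mem_set ?mulr1//; exact: in_gt0.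
Qed.

Lemma measurable_gt0 : measurable (`]0, +oo[%classic : set (measurableTypeR R)).
Proof. exact: measurable_itv. Qed.

Lemma measurable_smooth (A : set R) (phi : R -> R) : smooth_on setT phi ->
  measurable_fun (A : set (measurableTypeR R)) (phi : measurableTypeR R -> R).
Proof.
move=> sphi; apply: measurable_funTS; apply: continuous_measurable_fun => s.
exact: (smooth_on_continuous sphi I).
Qed.

Lemma test_function0 (phi : R -> R) (s : R) : test_function phi -> s <= 0 -> phi s = 0.
Proof.
move=> /test_functionP[_ [e [T [e0 HT]]]] s0; apply/eqP.
by apply: contraTT s0 => /HT/andP[es _]; rewrite -ltNge (lt_le_trans e0).
Qed.

Lemma Rintegral_cm_density g cg (phi : R -> R) : test_function phi ->
  \int[cm_density g cg]_(s in `]0, +oo[) phi s =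
  \int[cm_measure g cg]_(s in `[0, +oo[) (s `^ (1 - lambda) * phi s).
Proof.
move=> tphi; rewrite Rintegral_density; last 2 first.
- exact: measurable_gt0.
- by apply: measurable_smooth; exact: test_smooth.
rewrite Rintegral_mkcond [RHS]Rintegral_mkcond; apply: eq_Rintegral => s _.
rewrite !patchE !mem_setE /= !in_itv/= !andbT.
have [s0|s0] := ltP 0 s; first by rewrite ltW// power_weightE// mulrC.
by case: ifP => // _; rewrite (test_function0 _ _ tphi s0) mulr0.
Qed.

Lemma cm_density_pos_measure g cg : pos_measure (cm_density g cg).
Proof.
split.
  rewrite /cm_density/= /density_fun integral0_eq// => s; rewrite /= in_itv/= => s0.
  rewrite /power_weight indicE memNset ?mulr0//= in_itv/= andbT.
  by apply/negP; rewrite -leNgt.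
move=> K cK K0.
have [K00|/set0P[k0 Kk0]] := eqVneq K set0; first by rewrite K00 measure0.
have cid : {within K, continuous (fun s : R => s)}.
  by apply: continuous_subspaceT => s; exact: cvg_id.
have [b Kb bmax] := compact_EVT_max (ex_intro _ _ Kk0) cK cid.
have cp : {within K, continuous (fun s : R => s `^ (1 - lambda))}.
  apply: continuous_in_subspaceT => s /[!inE] Ks.
  exact: (smooth_on_continuous (smooth_on_powR _) (K0 _ Ks)).
have [m Km mmax] := compact_EVT_max (ex_intro _ _ Kk0) cK cp.
have mK : measurable (K : set (measurableTypeR R)) by exact: compact_measurable.
rewrite /cm_density/= /density_fun.
apply: (@le_lt_trans _ _ (\int[cm_measure g cg]_(s in K) (m `^ (1 - lambda))%:E)%E).
  apply: ge0_le_integral => //.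
  - by move=> s _; rewrite lee_fin power_weight_ge0.
  - by apply: measurable_EFinR; apply: measurable_funTS; exact: measurable_power_weight.
  - move=> s Ks; rewrite lee_fin power_weightE ?mmax ?inE//.
    by have /= := K0 _ Ks; rewrite in_itv/= andbT.
rewrite integral_cst// lte_mul_pinfty ?lee_fin ?powR_ge0//.
apply: le_lt_trans (cm_measure_itvcc g cg b _); last first.
  by have /= := K0 _ (set_mem Kb); rewrite in_itv/= andbT => /ltW.
apply: le_measure; rewrite ?inE//.
move=> s Ks; rewrite /= in_itv/= bmax ?inE// andbT.
by have /= := K0 _ Ks; rewrite in_itv/= andbT => /ltW.
Qed.

Lemma laplace_cm_density g cg (x : R) :
  laplace lambda (cm_density g cg) x =
  (\int[cm_measure g cg]_(s in `]0%R, +oo[) (expR (- (x * s)))%:E)%E.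
Proof.
rewrite /laplace ge0_integral_density; last 3 first.
- exact: measurable_gt0.
- apply: measurable_EFinR; apply: measurable_funM; first exact: measurable_expRN.
  by apply: measurable_funTS; exact: measurable_powR.
- by move=> s _; rewrite lee_fin mulr_ge0 ?expR_ge0 ?powR_ge0.
apply: eq_integral => s; rewrite inE/= in_itv/= andbT => s0.
rewrite power_weightE// -EFinM -mulrA -powRD; last by rewrite (gt_eqF s0) implybT.
have -> : lambda - 1 + (1 - lambda) = 0 by ring.
by rewrite powRr0 mulr1.
Qed.

(** Origin of the constant c: the kernel equals 1 at s = 0, so the atom there contributes its mass
    for every x. *)
Lemma cm_representation g cg (x : R) : 0 < x ->
  (g x)%:E = ((fine (cm_measure g cg [set 0%R]))%:E +
    laplace lambda (cm_density g cg) x)%E.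
Proof.
move=> x0; rewrite laplace_cm_density -(cm_measure_laplace g cg x x0).
have -> : `[0, +oo[%classic = [set 0] `|` `]0, +oo[%classic :> set (measurableTypeR R).
  by rewrite setU1itv.
have dis : [disjoint ([set 0] : set (measurableTypeR R)) & `]0, +oo[%classic].
  by apply/disj_setPS => s [/= -> ]; rewrite in_itv/= ltxx.
have m1 : measurable ([set 0%R] : set (measurableTypeR R)) by exact: measurable_set1.
rewrite (@ge0_integral_setU _ (measurableTypeR R) R (cm_measure g cg) _ _ m1 measurable_gt0
  (fun s => (expR (- (x * s)))%:E) _ _ dis); last 2 first.
- exact: (measurable_EFinR (measurable_expRN x _)).
- by move=> s _; rewrite lee_fin expR_ge0.
congr (_ + _)%E.
rewrite (eq_integral (cst 1%E)); last first.
  by move=> s; rewrite inE/= => ->; rewrite mulr0 oppr0 expR0.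
rewrite integral_cst ?mul1e//.
rewrite fineK// ge0_fin_numE//.
have := cm_measure_itvcc g cg 0 (lexx _); rewrite set_itv1; exact.
Qed.

End CompletelyMonotonic.

(** * The recursion on the side of test functions *)

Section EulerTestFunctions.
Context {R : realType}.
Implicit Types phi : R -> R.

Definition euler_test (a : R) phi (s : R) : R := a * phi s + s * derive1 phi s.

Lemma test_function_euler a phi : test_function phi -> test_function (euler_test a phi).
Proof.
move=> tphi; apply: test_function_add.
  exact: test_function_mul (smooth_on_cst _ a open_gt0) tphi.
exact: test_function_mul (smooth_on_id _ open_gt0) (test_function_derive1 _ tphi).
Qed.

Lemma euler_test_mulX k phi s : test_function phi ->
  s ^+ k * euler_test k.+1%:R phi s = derive1 (fun t => t ^+ k.+1 * phi t) s.
Proof.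
move=> tphi; rewrite derive1E.
have dX := isder_mul (isder_exp k (isder_id s)) (test_function_is_derive _ s tphi).
have [_ ->] := dX; rewrite /euler_test exprS; ring.
Qed.

(** Differentiating s^(1 - lambda) contributes 1 - lambda, which turns lambda + k into k + 1. At s =
    0 both sides vanish with phi. *)
Lemma euler_test_powR (lambda : R) k phi : test_function phi ->
  let psi (s : R) := s `^ (1 - lambda) * phi s in
  forall s, 0 <= s -> (lambda + k%:R) * psi s + s * derive1 psi s =
    s `^ (1 - lambda) * euler_test k.+1%:R phi s.
Proof.
move=> tphi psi s; rewrite le_eqVlt => /predU1P[<-|s0].
  by rewrite /psi /euler_test (test_function0 _ _ tphi (lexx 0)) !mul0r !mulr0 !addr0 mulr0.
have [_] := isder_mul (is_derive_powR (1 - lambda) s s0) (test_function_is_derive _ s tphi).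
rewrite -derive1E => ->.
rewrite powRB; last by rewrite (gt_eqF s0) implybT.
rewrite powRr1 ?(ltW s0)// /psi /euler_test -natr1; field; exact: lt0r_neq0.
Qed.

Lemma iter_distr_deriv k (u : distr R) phi :
  iter k (@distr_deriv R) u phi = (-1) ^+ k * u (derive1n k phi).
Proof.
elim: k phi => [|k IHk] phi; first by rewrite expr0 mul1r.
by rewrite iterS /distr_deriv IHk -derive1Sn exprS mulN1r mulNr.
Qed.

(** The sign in the definition of mu_k cancels the sign from moving k derivatives onto the test
    function. *)
Lemma signed_distr_deriv k (u : distr R) phi :
  distr_scale ((-1) ^+ k) (distr_mulX k (iter k (@distr_deriv R) u)) phi =
  u (derive1n k (fun s => s ^+ k * phi s)).
Proof.
by rewrite /distr_scale /distr_mulX iter_distr_deriv mulrA -exprMn mulrNN mulr1 expr1n mul1r.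
Qed.

Lemma derive1n_euler_test k phi : test_function phi ->
  derive1n k (fun s => s ^+ k * euler_test k.+1%:R phi s) =
  derive1n k.+1 (fun s => s ^+ k.+1 * phi s).
Proof.
by move=> tphi; rewrite derive1Sn; congr derive1n; apply/funext => s; exact: euler_test_mulX.
Qed.

End EulerTestFunctions.

Lemma class_C_representation {R : realType} (lambda : R) (N : nat) (f : R -> R) :
  class_C lambda N f ->
  exists (c : R) (mu : {measure set (measurableTypeR R) -> \bar R}),
    representation lambda N f c mu.
Proof.
(* A single ultrafilter, chosen before k, serves all the measures; [cm_measure_euler] relates only
   measures built along the same one. *)
move=> [sf cmf]; have [U [UU UN]] := ultraFilterLemma eventually_filter.
pose alpha k kN := cm_measure U UU UN (ck lambda k f) (cmf k kN).
pose nu k kN := cm_density U UU UN lambda (ck lambda k f) (cmf k kN).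
have step k (kN : (k <= N)%N) (kN1 : (k.+1 <= N)%N) phi : test_function phi ->
    distr_of_measure (nu k.+1 kN1) phi =
    distr_of_measure (nu k kN) (euler_test k.+1%:R phi).
  move=> tphi.
  have e1 := Rintegral_cm_density U UU UN lambda _ (cmf k.+1 kN1) phi tphi.
  have e2 := Rintegral_cm_density U UU UN lambda _ (cmf k kN)
    (euler_test k.+1%:R phi) (test_function_euler k.+1%:R phi tphi).
  apply: (etrans e1); apply: (etrans _ (esym e2)).
  have tpsi : test_function (fun s => s `^ (1 - lambda) * phi s).
    exact: test_function_mul (smooth_on_powR _) tphi.
  apply: (etrans (cm_measure_euler U UU UN _ (cmf k kN) _ (cmf k.+1 kN1)
    (lambda + k%:R) _ _ tpsi)); last first.
    apply: eq_Rintegral => s; rewrite inE/= in_itv/= andbT => s0.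
    exact (euler_test_powR lambda k phi tphi s s0).
  move=> x x0; rewrite derive1E; have [_ ->] := is_derive_ck lambda k f x sf x0.
  by field; apply: lt0r_neq0.
have nuE k (kN : (k <= N)%N) phi : test_function phi ->
    distr_of_measure (nu k kN) phi =
    distr_of_measure (nu 0%N (leq0n N)) (derive1n k (fun s => s ^+ k * phi s)).
  elim: k kN phi => [|k IHk] kN phi tphi.
    rewrite (_ : leq0n N = kN); last exact: bool_irrelevance.
    by congr distr_of_measure; apply/funext => s; rewrite /= mul1r.
  have kN' := ltnW kN.
  apply: (etrans (step k kN' kN phi tphi)).
  apply: (etrans (IHk kN' _ (test_function_euler _ _ tphi))).
  by congr distr_of_measure; exact: derive1n_euler_test.
pose c := fine (alpha 0%N (leq0n N) [set 0]).
have fin_laplace k kN x : 0 < x -> (laplace lambda (nu k kN) x < +oo)%E.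
  move=> x0; have := cm_representation U UU UN lambda _ (cmf k kN) x x0.
  by rewrite -/(nu k kN); case: laplace => [r _||_]; rewrite ?ltry ?ltNyr.
exists c, (nu 0%N (leq0n N)); split.
- exact: fine_ge0.
- exact: cm_density_pos_measure.
- move=> x x0; rewrite -(ck0 lambda f x x0).
  exact: cm_representation.
- move=> k kN; exists (nu k kN); split; last by move=> x; exact: fin_laplace.
  split; first exact: cm_density_pos_measure.
  by move=> phi tphi; rewrite signed_distr_deriv; exact: nuE.
Qed.

Lemma expr_expRN_le {R : realType} n (y : R) : 0 < y ->
  y ^+ n * expR (- y) <= n`!%:R.
Proof.
move=> y0; have f0 : 0 < n`!%:R :> R by rewrite ltr0n fact_gt0.
rewrite expRN ler_pdivrMr ?expR_gt0// mulrC -ler_pdivrMr//.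
case: n f0 => [|n] f0; first by rewrite expr0 divr1 -expR0 ler_expR ltW.
have := @expR_ge1Dxn R y n (ltW y0); lra.
Qed.

(** * Smooth cutoffs *)

Section Flat.
Context {R : realType}.
Implicit Types s t : R.

(* Linear combinations of the [flat n] are closed under derivation, so that the
   smoothness of [flat 0] = exp (- 1 / t) needs no polynomials in 1 / t. *)
Definition flat (n : nat) t : R := if 0 < t then t^-1 ^+ n * expR (- t^-1) else 0.

Lemma flat_pos n t : 0 < t -> flat n t = t^-1 ^+ n * expR (- t^-1).
Proof. by rewrite /flat => ->. Qed.

Lemma flat_neg n t : t <= 0 -> flat n t = 0.
Proof. by rewrite /flat ltNge => ->. Qed.

Lemma flat_ge0 n t : 0 <= flat n t.
Proof.
rewrite /flat; case: ifP => // t0.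
by rewrite mulr_ge0 ?expR_ge0// exprn_ge0// invr_ge0 ltW.
Qed.

Lemma flat_le n t : flat n t <= n`!%:R.
Proof.
rewrite /flat; case: ifP => [t0|_]; last by rewrite ler0n.
by apply: expr_expRN_le; rewrite invr_gt0.
Qed.

Lemma flat_le_inv n t : 0 < t -> flat n t <= t^-1 ^+ n.
Proof.
move=> t0; rewrite flat_pos// ler_piMr ?exprn_ge0 ?invr_ge0 ?(ltW t0)//.
by rewrite expR_le1 oppr_le0 invr_ge0 ltW.
Qed.

Lemma flatS n t : t * flat n.+1 t = flat n t.
Proof.
have [t0|t0] := ltP 0 t; last by rewrite !flat_neg// mulr0.
by rewrite !flat_pos// exprS !mulrA mulfV ?mul1r// gt_eqF.
Qed.

Lemma flat0_ge t : 0 < t -> 1 - t^-1 <= flat 0 t.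
Proof. by move=> t0; rewrite flat_pos// expr0 mul1r; exact: expR_ge1Dx. Qed.

Lemma flat0_nd s t : s <= t -> flat 0 s <= flat 0 t.
Proof.
move=> st; have [s0|s0] := leP s 0; first by rewrite flat_neg// flat_ge0.
have t0 := lt_le_trans s0 st.
by rewrite !flat_pos// !expr0 !mul1r ler_expR lerN2 lef_pV2.
Qed.

Lemma is_derive_flat n t :
  is_derive t 1 (flat n) (flat n.+2 t - n%:R * flat n.+1 t).
Proof.
have [t0|t0|->] := ltgtP t 0.
- have oI : open (`]-oo, 0[%classic : set R) by exact: interval_open.
  rewrite !flat_neg ?(ltW t0)// mulr0 subr0.
  apply: (is_derive_eq_on 0 oI _ _ (isder_cst 0 t)); last by rewrite /= in_itv/= t0.
  by move=> r; rewrite inE/= in_itv/= => /ltW r0; rewrite flat_neg.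
- have tn0 : t != 0 by rewrite gt_eqF.
  have dV := @isder_inv R (fun z => z) t 1 tn0 (isder_id t).
  have dE : is_derive t 1 (fun z : R => expR (- z^-1)) (t^-1 ^+ 2 * expR (- t^-1)).
    have -> : (fun z : R => expR (- z^-1)) = (fun z => expR (-1 * z^-1)).
      by apply/funext => z; rewrite mulN1r.
    apply: isder_eq (isder_comp (is_derive_expRM (-1) t^-1) dV) _.
    by rewrite !mulN1r; ring.
  apply: (is_derive_eq_on _ open_gt0 _ (in_gt0 _ t0)).
    by move=> r; rewrite inE/= in_itv/= andbT => r0; rewrite [RHS]flat_pos.
  rewrite !flat_pos//; case: n => [|n].
    rewrite mul0r subr0; under eq_fun do rewrite expr0 mul1r.
    exact: dE.
  apply: isder_eq (isder_mul (isder_exp n dV) dE) _.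
  rewrite !exprS; ring.
- rewrite !flat_neg// mulr0 subr0.
  (* At 0 the difference quotient of [flat n] is [flat n.+1], which tends to 0 because it equals z
     times the bounded function [flat n.+2]. *)
  apply/is_derive1_caratheodory; exists (flat n.+1); split.
  - by move=> z; rewrite (flat_neg n 0 (lexx 0)) !subr0 mulrC flatS.
  - have lip z : `|flat n.+1 z| <= n.+2`!%:R * `|z|.
      rewrite -flatS normrM mulrC; apply: ler_wpM2r => //.
      by rewrite ger0_norm ?flat_ge0// flat_le.
    have h0 : n.+2`!%:R * `|z| @[z --> (0 : R)] --> (0 : R).
      have := cvgM (@cvg_cst _ (n.+2`!%:R : R) _ (nbhs (0 : R)) _) (@norm_continuous _ R 0).
      by rewrite normr0 mulr0; apply.
    rewrite /prop_for /continuous_at (flat_neg n.+1 0 (lexx 0)).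
    apply: norm_cvg0.
    apply: (squeeze_cvgr _ (@cvg_cst _ (0 : R) _ (nbhs (0 : R)) _) h0).
    by apply: nearW => z; rewrite normr_ge0 lip.
  - by rewrite flat_neg.
Qed.

Inductive flat_span (c d : R) : (R -> R) -> Prop :=
| FlatSpan1 n k : flat_span c d (fun s => k * flat n (c * s + d))
| FlatSpanD g h : flat_span c d g -> flat_span c d h ->
    flat_span c d (fun s => g s + h s).

Lemma is_derive_affine c d s : is_derive s 1 (fun z => c * z + d) c.
Proof.
apply: isder_eq (isder_add (isder_scale c (isder_id s)) (isder_cst d s)) _.
by rewrite mulr1 addr0.
Qed.

Lemma is_derive_flat_affine n c d s :
  is_derive s 1 (fun z => flat n (c * z + d))
    ((flat n.+2 (c * s + d) - n%:R * flat n.+1 (c * s + d)) * c).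
Proof. exact: isder_comp (is_derive_flat n _) (is_derive_affine c d s). Qed.

Lemma smooth_flat n c d : smooth_on setT (fun s => flat n (c * s + d)).
Proof.
apply: (smooth_on_coind (flat_span c d) openT); last first.
  have -> : (fun s => flat n (c * s + d)) = (fun s => 1 * flat n (c * s + d)).
    by apply/funext => s; rewrite mul1r.
  exact: FlatSpan1.
move=> h; elim=> {h} [m k|g h _ [g' Cg' dg] _ [h' Ch' dh]].
  exists (fun s => k * c * flat m.+2 (c * s + d) +
    - (k * m%:R * c) * flat m.+1 (c * s + d)).
    by apply: FlatSpanD; exact: FlatSpan1.
  move=> s _; apply: isder_eq (isder_scale k (is_derive_flat_affine m c d s)) _.
  ring.
exists (fun s => g' s + h' s); first exact: FlatSpanD.
by move=> s sT; exact: isder_add (dg s sT) (dh s sT).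
Qed.

End Flat.

Section Cutoff.
Context {R : realType}.
Implicit Types s : R.

(** Nonzero only for 1 / n < s < n. For fixed s > 0 it increases to 1 with n, which makes monotone
    convergence applicable. *)
Definition cutoff (n : nat) s : R := flat 0 (n%:R * s + -1) * flat 0 (-1 * s + n%:R).

Definition cutoff_deriv (n : nat) s : R :=
  flat 2 (n%:R * s + -1) * n%:R * flat 0 (-1 * s + n%:R) -
  flat 0 (n%:R * s + -1) * flat 2 (-1 * s + n%:R).

Lemma is_derive_cutoff n s : is_derive s 1 (cutoff n) (cutoff_deriv n s).
Proof.
apply: isder_eq (isder_mul (is_derive_flat_affine 0 n%:R (-1) s)
  (is_derive_flat_affine 0 (-1) n%:R s)) _.
rewrite /cutoff_deriv; ring.
Qed.

Lemma cutoff_ge0 n s : 0 <= cutoff n s.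
Proof. by rewrite mulr_ge0 ?flat_ge0. Qed.

Lemma cutoff_le1 n s : cutoff n s <= 1.
Proof. by rewrite mulr_ile1 ?flat_ge0// (le_trans (flat_le _ _)). Qed.

Lemma cutoff_nd s n m : 0 <= s -> (n <= m)%N -> cutoff n s <= cutoff m s.
Proof.
move=> s0 nm; apply: ler_pM; rewrite ?flat_ge0//; apply: flat0_nd.
  by rewrite lerD2r ler_wpM2r// ler_nat.
by rewrite lerD2l ler_nat.
Qed.

Lemma test_function_cutoff n : test_function (cutoff n).
Proof.
apply/test_functionP; split.
  exact: smooth_onM openT (smooth_flat _ _ _) (smooth_flat _ _ _).
(* 1 / (n + 1) instead of 1 / n, so that the bound is positive for n = 0 as well. *)
exists n.+1%:R^-1, n%:R; split; first by rewrite invr_gt0.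
move=> s; rewrite mulf_eq0 negb_or => /andP[b1 b2].
have n1 : 0 < n%:R * s + -1.
  by rewrite ltNge; apply: contra b1 => h; rewrite flat_neg.
have n2 : 0 < -1 * s + n%:R.
  by rewrite ltNge; apply: contra b2 => h; rewrite flat_neg.
have s0 : 0 < s.
  rewrite ltNge; apply/negP => s0; have : n%:R * s <= 0 by rewrite mulr_ge0_le0.
  lra.
apply/andP; split; last lra.
rewrite -[leLHS]mul1r ler_pdivrMr// mulrC -natr1; nra.
Qed.

(** The chain rule produces a factor n. With t = n s - 1 one has n s = t + 1, and t [flat 2 t] =
    [flat 1 t] absorbs it; what remains is bounded uniformly in n, by 1 + 2 for the first term and 2
    s for the second. *)
Lemma cutoff_derivE n s : s * cutoff_deriv n s =
  (flat 1 (n%:R * s + -1) + flat 2 (n%:R * s + -1)) * flat 0 (-1 * s + n%:R) -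
  s * (flat 0 (n%:R * s + -1) * flat 2 (-1 * s + n%:R)).
Proof. rewrite /cutoff_deriv -(flatS 1 (n%:R * s + -1)); ring. Qed.

Lemma cutoff_deriv_le n s : 0 < s -> `|s * cutoff_deriv n s| <= 3 + 2 * s.
Proof.
move=> s0; rewrite cutoff_derivE; set t := n%:R * s + -1; set r := -1 * s + n%:R.
have b0 (u : R) : 0 <= flat 0 u <= 1 by rewrite flat_ge0 (le_trans (flat_le _ _)).
have b1 (u : R) : 0 <= flat 1 u <= 1 by rewrite flat_ge0 (le_trans (flat_le _ _)).
have b2 (u : R) : 0 <= flat 2 u <= 2 by rewrite flat_ge0 (le_trans (flat_le _ _)).
rewrite (le_trans (ler_normB _ _))//; apply: lerD.
  rewrite normrM -[leRHS]mulr1; apply: ler_pM => //.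
    by have /andP[p1 q1] := b1 t; have /andP[p2 q2] := b2 t; rewrite ger0_norm; lra.
  by have /andP[p1 q1] := b0 r; rewrite ger0_norm.
rewrite !normrM (ger0_norm (ltW s0)) mulrC; apply: ler_wpM2r; first exact: ltW.
rewrite -[leRHS]mul1r; apply: ler_pM => //.
  by have /andP[p1 q1] := b0 t; rewrite ger0_norm.
by have /andP[p1 q1] := b2 r; rewrite ger0_norm.
Qed.

Lemma affine_cvgy (c d : R) : 0 < c -> n%:R * c + d @[n --> \oo] --> +oo.
Proof.
move=> c0; apply/cvgryPge => A.
exists (Num.truncn ((A - d) / c)).+1 => // n /= nA.
have : (A - d) / c <= n%:R.
  by rewrite (le_trans (ltW (truncnS_gt _)))// ler_nat.
rewrite ler_pdivrMr//; lra.
Qed.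

Lemma inv_cvg0 (u : nat -> R) : u n @[n --> \oo] --> +oo ->
  (u n)^-1 @[n --> \oo] --> (0 : R).
Proof.
move=> uy; apply/(@gtr0_cvgV0 R nat \oo _ u) => //.
by move/cvgryPgt : uy => /(_ 0).
Qed.

Lemma flat0_cvg1 (u : nat -> R) : u n @[n --> \oo] --> +oo ->
  flat 0 (u n) @[n --> \oo] --> (1 : R).
Proof.
move=> uy; have lo : 1 - (u n)^-1 @[n --> \oo] --> (1 : R).
  have := cvgB (@cvg_cst _ (1 : R) _ \oo _) (inv_cvg0 _ uy).
  by rewrite subr0; apply.
apply: (squeeze_cvgr _ lo (@cvg_cst _ (1 : R) _ \oo _)).
have /cvgryPgt/(_ 0) := uy; apply: filterS => n u0.
by rewrite flat0_ge//= (le_trans (flat_le _ _)).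
Qed.

Lemma flatS_cvg0 k (u : nat -> R) : u n @[n --> \oo] --> +oo ->
  flat k.+1 (u n) @[n --> \oo] --> (0 : R).
Proof.
move=> uy; apply: (squeeze_cvgr _ (@cvg_cst _ (0 : R) _ \oo _) (inv_cvg0 _ uy)).
have /cvgryPge/(_ 1) := uy; apply: filterS => n u1.
have u0 : 0 < u n by exact: lt_le_trans ltr01 u1.
rewrite flat_ge0/= (le_trans (flat_le_inv _ _ u0))// exprS ler_piMr ?invr_ge0 ?(ltW u0)//.
by rewrite exprn_ile1 ?invr_ge0 ?(ltW u0)// invf_le1.
Qed.

Lemma cutoff_arg1_cvgy s : 0 < s -> n%:R * s + -1 @[n --> \oo] --> +oo.
Proof. exact: affine_cvgy. Qed.

Lemma cutoff_arg2_cvgy s : -1 * s + n%:R @[n --> \oo] --> +oo.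
Proof.
have := affine_cvgy 1 (-1 * s) ltr01.
by under eq_fun do rewrite mulr1 addrC.
Qed.

Lemma cutoff_cvg s : 0 < s -> cutoff n s @[n --> \oo] --> (1 : R).
Proof.
move=> s0; have := cvgM (flat0_cvg1 _ (cutoff_arg1_cvgy _ s0))
  (flat0_cvg1 _ (cutoff_arg2_cvgy s)).
by rewrite mulr1; apply.
Qed.

Lemma cutoff_deriv_cvg s : 0 < s -> s * cutoff_deriv n s @[n --> \oo] --> (0 : R).
Proof.
move=> s0; under eq_fun do rewrite cutoff_derivE.
have t := cutoff_arg1_cvgy _ s0; have r := cutoff_arg2_cvgy s.
have := cvgB (cvgM (cvgD (flatS_cvg0 0 _ t) (flatS_cvg0 1 _ t)) (flat0_cvg1 _ r))
  (cvgM (@cvg_cst _ s _ \oo _) (cvgM (flat0_cvg1 _ t) (flatS_cvg0 1 _ r))).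
by rewrite addr0 mul0r !mulr0 subr0; apply.
Qed.

End Cutoff.

(** * Laplace transforms *)

Section LaplaceMoments.
Context {R : realType}.
Variables (lambda : R) (nu : {measure set (measurableTypeR R) -> \bar R}).
Hypothesis nu_fin : forall x : R, 0 < x -> (laplace lambda nu x < +oo)%E.

Let D : set (measurableTypeR R) := `]0, +oo[%classic.

Definition laplace_kernel (x s : R) : R := expR (- (x * s)) * s `^ (lambda - 1).

Lemma laplace_kernel_ge0 x s : 0 <= laplace_kernel x s.
Proof. by rewrite mulr_ge0 ?expR_ge0 ?powR_ge0. Qed.

Lemma measurable_laplace_kernel x :
  measurable_fun D (laplace_kernel x : measurableTypeR R -> R).
Proof.
apply: measurable_funM; first exact: measurable_expRN.
by apply: measurable_funTS; exact: measurable_powR.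
Qed.

Lemma integrable_laplace_kernel x : 0 < x ->
  nu.-integrable D (EFin \o laplace_kernel x).
Proof.
move=> x0; apply/integrableP; split.
  exact: (measurable_EFinR (measurable_laplace_kernel x)).
apply: le_lt_trans (nu_fin x x0); rewrite /laplace.
rewrite (eq_integral (fun s : measurableTypeR R => (laplace_kernel x s)%:E))//.
by move=> s _; rewrite /= ger0_norm// laplace_kernel_ge0.
Qed.

(** Half of the exponent absorbs the power: (x s / 2)^j exp (- x s / 2) <= j!. Hence finiteness of
    the transform at every point gives all moments at every point. *)
Lemma moment_le j (x s : R) : 0 < x -> 0 <= s ->
  s ^+ j * laplace_kernel x s <= j`!%:R * (2 / x) ^+ j * laplace_kernel (x / 2) s.
Proof.
move=> x0; rewrite le_eqVlt => /predU1P[<-|s0].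
  rewrite expr0n; case: j => [|j] /=; last first.
    rewrite mul0r mulr_ge0 ?laplace_kernel_ge0// mulr_ge0// exprn_ge0// divr_ge0//.
    exact: ltW.
  by rewrite fact0 expr0 !mul1r /laplace_kernel !mulr0.
have y0 : 0 < x / 2 * s by rewrite mulr_gt0// divr_gt0.
have := expr_expRN_le j _ y0.
have -> : s ^+ j = (2 / x) ^+ j * (x / 2 * s) ^+ j.
  by rewrite -exprMn; congr (_ ^+ _); field; exact: lt0r_neq0.
have -> : laplace_kernel x s = expR (- (x / 2 * s)) * laplace_kernel (x / 2) s.
  rewrite /laplace_kernel mulrA -expRD (_ : - (x / 2 * s) + - (x / 2 * s) = - (x * s))//.
  by field.
move=> h; rewrite [leRHS]mulrAC.
have -> : (2 / x) ^+ j * (x / 2 * s) ^+ j *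
      (expR (- (x / 2 * s)) * laplace_kernel (x / 2) s) =
    ((x / 2 * s) ^+ j * expR (- (x / 2 * s))) * laplace_kernel (x / 2) s *
      (2 / x) ^+ j by ring.
apply: ler_wpM2r; first by rewrite exprn_ge0// divr_ge0// ltW.
by apply: ler_wpM2r; first exact: laplace_kernel_ge0.
Qed.

Lemma integrable_moment j (x : R) : 0 < x ->
  nu.-integrable D (EFin \o (fun s => s ^+ j * laplace_kernel x s)).
Proof.
move=> x0; have x20 : 0 < x / 2 by rewrite divr_gt0.
have mD : measurable D by exact: measurable_gt0.
apply: (le_integrable mD _ _ (integrableZl mD (j`!%:R * (2 / x) ^+ j)
  (integrable_laplace_kernel _ x20))).
  apply: measurable_EFinR; apply: measurable_funM; last exact: measurable_laplace_kernel.
  by apply: measurable_funX; exact: measurable_id.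
move=> s; rewrite /D/= in_itv/= andbT => s0.
rewrite lee_fin ger0_norm; last by rewrite mulr_ge0 ?exprn_ge0 ?laplace_kernel_ge0 ?ltW.
by rewrite (le_trans (moment_le j x s x0 (ltW s0)))// ler_norm.
Qed.

(** The j-th derivative of the transform of nu, as a real number. *)
Definition moment (j : nat) (x : R) : R :=
  \int[nu]_(s in D) ((-1) ^+ j * (s ^+ j * laplace_kernel x s)).

Lemma is_derive_moment j (x : R) : 0 < x ->
  is_derive x 1 (moment j) (moment j.+1 x).
Proof.
move=> x0; have x20 : 0 < x / 2 by rewrite divr_gt0.
have mD : measurable D by exact: measurable_gt0.
pose F (y : R) (s : measurableTypeR R) : R := (-1) ^+ j * (s ^+ j * laplace_kernel y s).
(* Dominates the derivative for all y > x / 2; the absolute value makes it nonnegative on the whole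
   line. *)
pose G (s : measurableTypeR R) : R := `|s| ^+ j.+1 * laplace_kernel (x / 2) s.
have Ix : `]x / 2, x + 1[%classic x by rewrite /= in_itv/=; apply/andP; split; lra.
have dF (y : R) (s : measurableTypeR R) : is_derive y 1 (F ^~ s)
    ((-1) ^+ j.+1 * (s ^+ j.+1 * laplace_kernel y s)).
  have dE : is_derive y 1 (fun z : R => expR (- (z * s))) (- s * expR (- (y * s))).
    have -> : (fun z : R => expR (- (z * s))) = (fun z => expR (- s * z)).
      by apply/funext => z; rewrite mulNr mulrC.
    apply: isder_eq (is_derive_expRM (- (s : R)) y) _.
    by congr (_ * expR _); rewrite mulNr mulrC.
  apply: isder_eq (isder_scale ((-1) ^+ j) (isder_scale (s ^+ j)
    (isder_mul dE (isder_cst (s `^ (lambda - 1)) y)))) _.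
  rewrite /laplace_kernel !exprS; ring.
have intF y : `]x / 2, x + 1[%classic y -> nu.-integrable D (EFin \o F y).
  rewrite /= in_itv/= => /andP[xy _]; have y0 := lt_trans x20 xy.
  exact: (integrableZl mD ((-1) ^+ j) (integrable_moment j y y0)).
have derF y s : `]x / 2, x + 1[%classic y -> D s -> derivable (F ^~ s) y 1.
  by move=> _ _; case: (dF y s).
have G0 s : 0 <= G s by rewrite mulr_ge0 ?exprn_ge0 ?laplace_kernel_ge0.
have intG : nu.-integrable D (EFin \o G).
  apply: eq_integrable (integrable_moment j.+1 _ x20) => // s.
  by rewrite inE /D/= in_itv/= andbT => s0; rewrite /G gtr0_norm.
have d1F y s : partial1of2 F y s = (-1) ^+ j.+1 * (s ^+ j.+1 * laplace_kernel y s).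
  by rewrite partial1of2E; case: (dF y s).
have FG y s : `]x / 2, x + 1[%classic y -> D s -> `|partial1of2 F y s| <= G s.
  rewrite /= in_itv/= /D/= in_itv/= andbT => /andP[xy _] s0.
  rewrite d1F !normrM normrX normrN1 expr1n mul1r normrX.
  apply: ler_wpM2l; first by rewrite exprn_ge0.
  rewrite (ger0_norm (expR_ge0 _)) (ger0_norm (powR_ge0 _ _)) /laplace_kernel.
  apply: ler_wpM2r; first exact: powR_ge0.
  by rewrite ler_expR lerN2 ler_wpM2r// ltW.
have dM := derivable_under_integral mD Ix intF derF G0 intG FG.
have eM := differentiation_under_integral mD Ix intF derF G0 intG FG.
have -> : moment j.+1 x = derive1 (moment j) x.
  by apply: etrans (esym eM); apply: eq_Rintegral => s _; rewrite d1F.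
by rewrite derive1E; exact: derivableP.
Qed.

Lemma laplace_moment (x : R) : 0 < x -> laplace lambda nu x = (moment 0 x)%:E.
Proof.
move=> x0; rewrite /moment /Rintegral fineK; last first.
  apply: integrable_fin_num; first exact: measurable_gt0.
  exact: (integrableZl measurable_gt0 1 (integrable_moment 0 x x0)).
by apply: eq_integral => s _; rewrite !expr0 !mul1r.
Qed.

Lemma moment_sign j (x : R) : 0 < x -> 0 <= (-1) ^+ j * moment j x.
Proof.
move=> x0; rewrite /moment RintegralZl; last 2 first.
- exact: measurable_gt0.
- exact: integrable_moment.
rewrite mulrA -exprMn mulrNN mulr1 expr1n mul1r; apply: Rintegral_ge0 => s.
rewrite /D/= in_itv/= andbT => s0.
by rewrite mulr_ge0 ?laplace_kernel_ge0 ?exprn_ge0// ltW.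
Qed.

Lemma derive1n_moment n (g : R -> R) (c : R) :
  (forall x, 0 < x -> g x = c + moment 0 x) ->
  forall x, 0 < x -> derive1n n g x = (if n is 0 then c else 0) + moment n x.
Proof.
move=> gE x x0; have xI := in_gt0 _ x0.
pose G n y := (if n is 0 then c else 0) + moment n y.
have dG m (y : R) : `]0, +oo[%classic y -> is_derive y 1 (G m) (G m.+1 y).
  rewrite /= in_itv/= andbT => y0; rewrite {2}/G add0r.
  have := isder_add (isder_cst (if m is 0 then c else 0) y) (is_derive_moment m y y0).
  by rewrite add0r.
rewrite -[RHS]/(G n x) -(derive1n_unique G open_gt0 dG) ?inE//.
apply: (derive1n_eq_on n open_gt0); last by rewrite inE.
by move=> y; rewrite inE/= in_itv/= andbT => /gE.
Qed.

Lemma smooth_on_moment (g : R -> R) (c : R) :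
  (forall x, 0 < x -> g x = c + moment 0 x) -> smooth_on `]0, +oo[ g.
Proof.
move=> gE n x; rewrite /= in_itv/= andbT => x0; have xI := in_gt0 _ x0.
have [dm _] := is_derive_moment n x x0.
have d : derivable (fun y => (if n is 0 then c else 0) + moment n y) x 1.
  exact: derivableD (derivable_cst _ _ _) dm.
apply: near_eq_derivable d.
have := open_nbhs_nbhs (conj open_gt0 xI); apply: filterS => y.
by rewrite /= in_itv/= andbT => y0; rewrite (derive1n_moment n _ _ gE).
Qed.

Lemma completely_monotonic_moment (g : R -> R) (c : R) : 0 <= c ->
  (forall x, 0 < x -> g x = c + moment 0 x) -> completely_monotonic g.
Proof.
move=> c0 gE; split; first exact: smooth_on_moment gE.
move=> n x x0; rewrite (derive1n_moment n _ _ gE _ x0) mulrDr addr_ge0//.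
  by case: n => [|n]; rewrite ?expr0 ?mul1r ?mulr0.
exact: moment_sign.
Qed.

End LaplaceMoments.

Section CutoffLimits.
Context {R : realType}.
Variable lambda : R.
Implicit Types nu : {measure set (measurableTypeR R) -> \bar R}.

Let kernel := @laplace_kernel R lambda.

Lemma integrable_test_function nu (phi : R -> R) : pos_measure nu ->
  test_function phi -> nu.-integrable `]0, +oo[ (EFin \o phi).
Proof.
move=> [_ nuK] tphi; have [L phiL] := test_function_bounded _ tphi.
have [sphi [e [T [e0 HT]]]] := (test_functionP _).1 tphi.
have mI : measurable (`[e, T]%classic : set (measurableTypeR R)) by exact: measurable_itv.
have nuI : (nu `[e, T]%classic < +oo)%E.
  apply: nuK; first exact: segment_compact.
  by move=> s; rewrite /= !in_itv/= andbT => /andP[es _]; exact: lt_le_trans es.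
have i1 : nu.-integrable (`]0, +oo[%classic : set (measurableTypeR R))
    (EFin \o (\1_(`[e, T]%classic) : measurableTypeR R -> R)).
  apply/integrableP; split.
    exact: (measurable_EFinR (@measurable_indic _ (measurableTypeR R) R _ _ mI)).
  rewrite (eq_integral (fun s : measurableTypeR R => (\1_(`[e, T]%classic) s)%:E)).
    rewrite integral_indic//.
    apply: le_lt_trans nuI; apply: le_measure; rewrite ?inE//.
    by apply: measurableI => //; exact: measurable_gt0.
  by move=> s _; rewrite /= ger0_norm// indicE.
apply: (le_integrable measurable_gt0 _ _ (integrableZl measurable_gt0 L i1)).
  by apply: measurable_EFinR; exact: measurable_smooth.
move=> s _; rewrite lee_fin indicE.
have [phi0|phis] := eqVneq (phi s) 0; first by rewrite phi0 normr0.
by rewrite mem_set /= ?in_itv/= ?HT// mulr1 (le_trans (phiL s))// ler_norm.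
Qed.

Lemma smooth_kernel (x : R) : smooth_on `]0, +oo[ (kernel x).
Proof.
apply: (smooth_onM open_gt0 _ (smooth_on_powR _)).
have -> : (fun s : R => expR (- (x * s))) = (fun s => expR (- x * s)).
  by apply/funext => s; rewrite mulNr.
exact: smooth_on_expRM open_gt0.
Qed.

Definition cut_kernel (x : R) (n : nat) (s : R) : R := kernel x s * cutoff n s.

Lemma test_function_cut_kernel x n : test_function (cut_kernel x n).
Proof. exact: test_function_mul (smooth_kernel x) (test_function_cutoff n). Qed.

(** Monotone convergence allows the limit to be infinite, so that [laplace_unique] can transfer
    finiteness from one measure to another. *)
Lemma cut_kernel_cvg nu (x : R) : pos_measure nu ->
  (distr_of_measure nu (cut_kernel x n))%:E @[n --> \oo] --> laplace lambda nu x.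
Proof.
move=> pnu; pose g n (s : measurableTypeR R) := (cut_kernel x n s)%:E.
have mg n : measurable_fun (`]0, +oo[%classic : set (measurableTypeR R)) (g n).
  apply: measurable_EFinR; apply: measurable_smooth; apply: test_smooth.
  exact: test_function_cut_kernel.
have g0 n s : `]0, +oo[%classic s -> (0 <= g n s)%E.
  by move=> _; rewrite lee_fin mulr_ge0 ?laplace_kernel_ge0 ?cutoff_ge0.
have gnd s : `]0, +oo[%classic s -> {homo g ^~ s : n m / (n <= m)%N >-> (n <= m)%E}.
  rewrite /= in_itv/= andbT => s0 n m nm; rewrite lee_fin.
  by rewrite ler_wpM2l ?laplace_kernel_ge0// cutoff_nd// ltW.
have gI n : (distr_of_measure nu (cut_kernel x n))%:E =
    (\int[nu]_(s in `]0%R, +oo[) g n s)%E.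
  rewrite /distr_of_measure /Rintegral fineK//; apply: integrable_fin_num.
    exact: measurable_gt0.
  exact: integrable_test_function pnu (test_function_cut_kernel x n).
under eq_fun do rewrite gI.
have -> : laplace lambda nu x = (\int[nu]_(s in `]0%R, +oo[) limn (g^~ s))%E.
  apply: eq_integral => s; rewrite inE/= in_itv/= andbT => s0; apply/esym.
  apply/cvg_lim => //; apply: cvg_EFin; first exact: nearW.
  have := cvgM (@cvg_cst _ (kernel x s) _ \oo _) (cutoff_cvg _ s0).
  by rewrite mulr1; apply.
exact: (cvg_monotone_convergence measurable_gt0 mg g0 gnd).
Qed.

Lemma laplace_unique nu nu' (x : R) : pos_measure nu -> pos_measure nu' ->
  distr_eq (distr_of_measure nu) (distr_of_measure nu') ->
  laplace lambda nu x = laplace lambda nu' x.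
Proof.
move=> pnu pnu' e; have c := cut_kernel_cvg nu x pnu.
have c' : (distr_of_measure nu (cut_kernel x n))%:E @[n --> \oo] --> laplace lambda nu' x.
  under eq_fun do rewrite (e _ (test_function_cut_kernel x _)).
  exact: cut_kernel_cvg.
exact: cvg_unique c c'.
Qed.

Lemma is_derive_kernel (x s : R) : 0 < s ->
  is_derive s 1 (kernel x) ((- x + (lambda - 1) / s) * kernel x s).
Proof.
move=> s0.
have dE : is_derive s 1 (fun s : R => expR (- (x * s))) (- x * expR (- (x * s))).
  have -> : (fun s : R => expR (- (x * s))) = (fun s => expR (- x * s)).
    by apply/funext => r; rewrite mulNr.
  by rewrite -mulNr; exact: is_derive_expRM.
apply: isder_eq (isder_mul dE (is_derive_powR (lambda - 1) s s0)) _.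
rewrite /kernel /laplace_kernel (@powRB _ s (lambda - 1) 1); last by rewrite (gt_eqF s0) implybT.
by rewrite powRr1 ?(ltW s0)//; field; exact: lt0r_neq0.
Qed.

Lemma euler_cut_kernel k (x : R) n (s : R) : 0 < s ->
  euler_test k.+1%:R (cut_kernel x n) s =
  (lambda + k%:R - x * s) * kernel x s * cutoff n s +
  kernel x s * (s * cutoff_deriv n s).
Proof.
move=> s0; rewrite /euler_test derive1E.
have [_ ->] := isder_mul (is_derive_kernel x s s0) (is_derive_cutoff n s).
by rewrite /cut_kernel -natr1; field; exact: lt0r_neq0.
Qed.

Lemma euler_cut_kernel_cvg k nu (x : R) : pos_measure nu -> 0 < x ->
  (forall y : R, 0 < y -> (laplace lambda nu y < +oo)%E) ->
  distr_of_measure nu (euler_test k.+1%:R (cut_kernel x n)) @[n --> \oo] -->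
  (lambda + k%:R) * moment lambda nu 0 x + x * moment lambda nu 1 x.
Proof.
move=> pnu x0 nufin; have mD := @measurable_gt0 R.
pose D : set (measurableTypeR R) := `]0, +oo[%classic.
pose F n (s : measurableTypeR R) := (euler_test k.+1%:R (cut_kernel x n) s)%:E.
pose G (s : measurableTypeR R) := ((lambda + k%:R - x * s) * kernel x s)%R%:E.
(* The sum of |lambda + k| + x s, from the first term of [euler_cut_kernel], and of 3 + 2 s, from
   [cutoff_deriv_le], times the kernel. *)
pose B (s : measurableTypeR R) : \bar R :=
  (((`|lambda + k%:R| + 3) * kernel x s + (x + 2) * (s ^+ 1 * kernel x s))%:E)%R.
have i0 := integrable_laplace_kernel lambda nu nufin x x0.
have i1 := integrable_moment lambda nu nufin 1 x x0.
have iB : nu.-integrable D B.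
  apply: (integrableD mD (integrableZl mD (`|lambda + k%:R| + 3) i0)
    (integrableZl mD (x + 2) i1)).
have iG : nu.-integrable D G.
  apply: eq_integrable (integrableD mD (integrableZl mD (lambda + k%:R) i0)
    (integrableZl mD (- x) i1)) => //.
  by move=> s _; rewrite /G /= -!EFinM -EFinD; congr (_%:E); rewrite expr1 /kernel; ring.
have tF n := test_function_euler k.+1%:R _ (test_function_cut_kernel x n).
have mF n : measurable_fun D (F n).
  by apply: measurable_EFinR; apply: measurable_smooth; exact: test_smooth.
have FG : {ae nu, forall s, D s -> F n s @[n --> \oo] --> G s}.
  apply: aeW => s; rewrite /D/= in_itv/= andbT => s0.
  apply: cvg_EFin; first exact: nearW.
  rewrite /F; under eq_fun do rewrite /= euler_cut_kernel//.
  have := cvgD (cvgM (@cvg_cst _ ((lambda + k%:R - x * s) * kernel x s) _ \oo _)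
    (cutoff_cvg _ s0)) (cvgM (@cvg_cst _ (kernel x s) _ \oo _) (cutoff_deriv_cvg _ s0)).
  by rewrite mulr1 mulr0 addr0; apply.
have FB : {ae nu, forall s n, D s -> (`|F n s| <= B s)%E}.
  apply: aeW => s n; rewrite /D/= in_itv/= andbT => s0.
  rewrite lee_fin euler_cut_kernel//.
  have k0 : 0 <= kernel x s by exact: laplace_kernel_ge0.
  rewrite (le_trans (ler_normD _ _))//.
  rewrite (normrM ((lambda + k%:R - x * s) * kernel x s) (cutoff n s)).
  rewrite (normrM (lambda + k%:R - x * s) (kernel x s)).
  rewrite (normrM (kernel x s) (s * cutoff_deriv n s)).
  rewrite (ger0_norm k0) (ger0_norm (cutoff_ge0 _ _)).
  have h1 := cutoff_le1 n s; have h0 := cutoff_ge0 n s.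
  have h2 := cutoff_deriv_le n s s0.
  have h3 : `|lambda + k%:R - x * s| <= `|lambda + k%:R| + x * s.
    by rewrite (le_trans (ler_normB _ _))// lerD2l ger0_norm// mulr_ge0// ltW.
  have h4 : `|lambda + k%:R - x * s| * kernel x s * cutoff n s <=
      (`|lambda + k%:R| + x * s) * kernel x s.
    rewrite -[leRHS]mulr1; apply: ler_pM => //; first by rewrite mulr_ge0.
    exact: ler_wpM2r.
  have h5 := ler_wpM2l k0 h2.
  apply: le_trans (lerD h4 h5) _; rewrite expr1; lra.
have [_ _ cv] := dominated_convergence mD mF (measurable_int _ iG) FG iB FB.
have -> : (lambda + k%:R) * moment lambda nu 0 x + x * moment lambda nu 1 x =
    fine (\int[nu]_(s in D) G s)%E.
  rewrite /moment -!RintegralZl//; last 2 first.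
  - exact: (integrableZl mD _ i1).
  - exact: (integrableZl mD _ (integrable_moment lambda nu nufin 0 x x0)).
  rewrite -RintegralD//; last 2 first.
  - exact: (integrableZl mD _ (integrableZl mD _ (integrable_moment lambda nu nufin 0 x x0))).
  - exact: (integrableZl mD _ (integrableZl mD _ i1)).
  by apply: eq_Rintegral => s _; rewrite !expr0 !expr1 /kernel; ring.
apply: fine_cvg; rewrite fineK//; exact: integrable_fin_num.
Qed.

End CutoffLimits.

(** * From the representation to the formula and to complete monotonicity *)

Section Representation.
Context {R : realType}.
Variables (lambda : R) (N : nat) (f : R -> R) (c : R).
Variable mu : {measure set (measurableTypeR R) -> \bar R}.
Hypothesis repr : representation lambda N f c mu.

Lemma is_mu_kE k (nu : {measure set (measurableTypeR R) -> \bar R}) phi :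
  is_mu_k k mu nu -> test_function phi ->
  distr_of_measure nu phi =
  distr_of_measure mu (derive1n k (fun s => s ^+ k * phi s)).
Proof. by move=> [_ e] /e ->; exact: signed_distr_deriv. Qed.

Lemma is_mu_k_unique k (nu nu' : {measure set (measurableTypeR R) -> \bar R}) x :
  is_mu_k k mu nu -> is_mu_k k mu nu' ->
  laplace lambda nu x = laplace lambda nu' x.
Proof.
move=> h h'; apply: laplace_unique; [by case: h|by case: h'|].
by move=> phi tphi; rewrite (is_mu_kE _ _ _ h tphi) (is_mu_kE _ _ _ h' tphi).
Qed.

(** The representation asserts finiteness for some measure representing mu_k; any other one has the
    same transform. *)
Lemma is_mu_k_laplace_fin k nu (x : R) : (k <= N)%N -> is_mu_k k mu nu -> 0 < x ->
  (laplace lambda nu x < +oo)%E.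
Proof.
move=> kN h x0; have [_ _ _ ex] := repr; have [nu' [h' fin]] := ex _ kN.
by rewrite (is_mu_k_unique k nu nu' x h h'); exact: fin.
Qed.

Lemma is_mu_0_laplace nu (x : R) : is_mu_k 0 mu nu ->
  laplace lambda nu x = laplace lambda mu x.
Proof.
move=> h; have [_ pmu _ _] := repr; apply: laplace_unique => //; first by case: h.
move=> phi tphi; rewrite (is_mu_kE _ _ _ h tphi); congr distr_of_measure.
by apply/funext => s; rewrite /= mul1r.
Qed.

Lemma representation_moment nu (x : R) : is_mu_k 0 mu nu -> 0 < x ->
  f x = c + moment lambda nu 0 x.
Proof.
move=> h x0; have [_ _ fE _] := repr; apply: EFin_inj.
rewrite fE// -(is_mu_0_laplace _ _ h) EFinD laplace_moment//.
by move=> y y0; exact: is_mu_k_laplace_fin (leq0n N) h y0.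
Qed.

Lemma representation_smooth : smooth_on `]0, +oo[ f.
Proof.
have [_ _ _ ex] := repr; have [nu [h fin]] := ex _ (leq0n N).
by apply: (smooth_on_moment lambda nu fin f c) => x x0; exact: representation_moment.
Qed.

Lemma euler_moment k nu nu' (x : R) : (k < N)%N -> is_mu_k k mu nu ->
  is_mu_k k.+1 mu nu' -> 0 < x ->
  moment lambda nu' 0 x =
  (lambda + k%:R) * moment lambda nu 0 x + x * moment lambda nu 1 x.
Proof.
move=> kN h h' x0.
have fin (y : R) := is_mu_k_laplace_fin k nu y (ltnW kN) h.
have fin' (y : R) := is_mu_k_laplace_fin k.+1 nu' y kN h'.
have pnu : pos_measure nu by case: h.
have pnu' : pos_measure nu' by case: h'.
have c1 := euler_cut_kernel_cvg lambda k nu x pnu x0 fin.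
have c2 : distr_of_measure nu (euler_test k.+1%:R (cut_kernel lambda x n))
    @[n --> \oo] --> moment lambda nu' 0 x.
  have E n : distr_of_measure nu (euler_test k.+1%:R (cut_kernel lambda x n)) =
      distr_of_measure nu' (cut_kernel lambda x n).
    have tc := test_function_cut_kernel lambda x n.
    rewrite (is_mu_kE _ _ _ h (test_function_euler _ _ tc)) (is_mu_kE _ _ _ h' tc).
    by congr distr_of_measure; exact: derive1n_euler_test.
  under eq_fun do rewrite E.
  have := cut_kernel_cvg lambda nu' x pnu'; rewrite (laplace_moment lambda nu' fin' x x0).
  exact: fine_cvg.
exact: cvg_unique c2 c1.
Qed.

(** Induction on k: the derivative of c_k is computed once from the recursion and once from the
    integral formula, and [euler_moment] identifies the result. The constant drops out of the
    derivative but is multiplied by lambda + k at each step, which builds up [rising lambda k]. *)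
Lemma ck_moment k nu (x : R) : (k <= N)%N -> is_mu_k k mu nu -> 0 < x ->
  ck lambda k f x = c * rising lambda k + moment lambda nu 0 x.
Proof.
elim: k nu x => [|k IHk] nu x kN h x0.
  by rewrite ck0// /rising big_ord0 mulr1; exact: representation_moment.
have [_ _ _ ex] := repr; have [nu' [h' fin']] := ex _ (ltnW kN).
have IH y : 0 < y -> _ := IHk nu' y (ltnW kN) h'.
have [_ e] := is_derive_ck lambda k f x representation_smooth x0.
have e' := derive1n_moment lambda nu' fin' 1 _ _ IH x x0.
move: e; rewrite -derive1E [derive1 _ x]e' add0r (IH x x0) => e.
rewrite (euler_moment k nu' nu x kN h' h x0).
rewrite {1}/rising big_ord_recr/= -/(rising lambda k).
have -> : x * moment lambda nu' 1 x = ck lambda k.+1 f x -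
    (lambda + k%:R) * (c * rising lambda k + moment lambda nu' 0 x).
  by rewrite e mulVKf// lt0r_neq0.
ring.
Qed.

(** Positivity of lambda enters through the sign of the constant [c * rising lambda k]. *)
Lemma representation_class_C : 0 < lambda -> class_C lambda N f.
Proof.
move=> l0; split; first exact: representation_smooth.
move=> k kN; have [c0 _ _ ex] := repr; have [nu [h fin]] := ex _ kN.
have lam0 : 0 <= c * rising lambda k.
  by rewrite mulr_ge0// prodr_ge0// => i _; rewrite addr_ge0 ?(ltW l0).
apply: (completely_monotonic_moment lambda nu fin _ _ lam0) => x x0.
exact: ck_moment.
Qed.

End Representation.

Theorem theorem1p6 (R : realType) (lambda : R) (N : nat) (f : R -> R)
    (hlambda : 0 < lambda) (hN : (1 <= N)%N) :
  (class_C lambda N f <->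
   exists (c : R) (mu : {measure set (measurableTypeR R) -> \bar R}),
     representation lambda N f c mu)
  /\
  (forall (c : R) (mu : {measure set (measurableTypeR R) -> \bar R}),
     representation lambda N f c mu ->
     forall (k : nat) (nu : {measure set (measurableTypeR R) -> \bar R}),
       (k <= N)%N -> is_mu_k k mu nu ->
       forall x : R, 0 < x ->
         (ck lambda k f x)%:E
         = ((c * rising lambda k)%:E + laplace lambda nu x)%E).
Proof.
split; last first.
  move=> c mu repr k nu kN h x x0.
  have fin (y : R) := is_mu_k_laplace_fin lambda N f c mu repr k nu y kN h.
  rewrite (ck_moment lambda N f c mu repr k nu x kN h x0) EFinD.
  by rewrite (laplace_moment lambda nu fin x x0).
split=> [|[c [mu repr]]]; first exact: class_C_representation.
exact: representation_class_C repr hlambda.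
Qed.
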